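(* Let $\varphi$ be an endomorphism of a subshift $(X,\sigma)$. Let $s\ge1$. (1) If $\varphi^s$ is weakly $q$-R, then so is $\varphi^{[^*s]}$, and hence $\varphi$ is essentially weakly $q$-R. If $\varphi^s$ is weakly $q$-L, then so is $\varphi^{[^*s]}$, and hence $\varphi$ is essentially weakly $q$-L. (2) When $(X,\sigma)$ is a topological Markov shift, if $\varphi$ is bijective or if $\varphi$ is onto with $\sigma$ topologically transitive, then: if $\varphi^s$ is $q$-R, then so is $(\varphi^{[^*s]})^{[t]}$ for some $t\ge1$; and if $\varphi^s$ is $q$-L, then so is $(\varphi^{[^*s]})^{[t]}$ for some $t\ge1$.
   Context: **Subshifts.** An alphabet is a finite set with at least two elements. For an alphabet $A$, $A^{\mathbb Z}$ carries the product topology; the shift maps $(a_j)_j$ to $(a_{j+1})_j$. A subshift $(X,\sigma)$ over $A$ is a closed $X\subset A^{\mathbb Z}$ with $\sigma(X)=X$, $\sigma$ being the restricted shift; $L_k(X)$ is the set of words of length $k$ occurring in points of $X$. An endomorphism of $(X,\sigma)$ is a continuous map $\varphi:X\to X$ commuting with $\sigma$ (not assumed onto). **Higher blocks.** For $t\ge1$, $X^{[t]}=\{(a_j\dots a_{j+t-1})_{j\in\mathbb Z}: (a_j)\in X\}$, a subshift over $L_t(X)$ with shift $\sigma^{[t]}$; if $\varphi((a_j))=(b_j)$ then $\varphi^{[t]}$ maps $(a_j\dots a_{j+t-1})_j$ to $(b_j\dots b_{j+t-1})_j$. **Dual higher blocks.** For $s\ge1$ and $x\in X$ let $\rho^*_{\varphi,s}(x)=((a_{i,j})_{0\le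 i\le s-1})_{j\in\mathbb Z}$, where $(a_{i,j})_{j\in\mathbb Z}=\varphi^i(x)$; let $X^{[^*_\varphi s]}=\rho^*_{\varphi,s}(X)$, a subshift over an alphabet contained in $L_1(X)^s$, with shift $\sigma^{[^*_\varphi s]}$. $\rho^*_{\varphi,s}:(X,\sigma)\to(X^{[^*_\varphi s]},\sigma^{[^*_\varphi s]})$ is a topological conjugacy, and $\varphi^{[^*s]}=\rho^*_{\varphi,s}\,\varphi\,(\rho^*_{\varphi,s})^{-1}$, an endomorphism of $(X^{[^*_\varphi s]},\sigma^{[^*_\varphi s]})$. **Graphs.** A graph is a finite directed graph $G$ (multiple arcs, loops allowed) with arc-set $A_G$, vertex-set $V_G$ and initial/terminal vertex maps $i_G,t_G$; it is nondegenerate if $i_G,t_G$ are onto. $X_G\subset A_G^{\mathbb Z}$ is the set of bi-infinite paths and $\sigma_G$ its shift; for $G$ nondegenerate, $(X_G,\sigma_G)$ is called a topological Markov shift. A graph-homomorphism $h=(h_A,h_V):\Gamma\to G$ is a pair of maps on arcs and vertices compatible with $i,t$; it induces $\phi_h:X_\Gamma\to X_G$, $(\alpha_j)\mapsto(h_A(\alpha_j))$. $h$ is weakly left-resolving (resp. weakly right-resolving) if every arc $\alpha$ of $\Gamma$ is uniquely determined by $t_\Gamma(\alpha)$ (resp. $i_\Gamma(\alpha)$) and $h_A(\alpha)$; it is left-resolving (resp. right-resolving) if for every $u\in V_\Gamma$, $a\in A_G$ with $t_G(a)=h_V(u)$ (resp. $i_G(a)=h_V(u)$) there is a unique $\alpha\in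 A_\Gamma$ with $h_A(\alpha)=a$ and $t_\Gamma(\alpha)=u$ (resp. $i_\Gamma(\alpha)=u$). **Resolving endomorphisms.** A textile system $T=(p,q:\Gamma\to G)$ is a pair of graph-homomorphisms $p,q:\Gamma\to G$. $T$ is (weakly) $q$-L if $q$ is (weakly) left-resolving, (weakly) $q$-R if $q$ is (weakly) right-resolving. For each of these terms $\mathcal P$: an endomorphism $\varphi$ of a subshift $(X,\sigma)$ is weakly $\mathcal P$ if there are a weakly $\mathcal P$ textile system $T=(p,q:\Gamma\to G)$ and a closed shift-invariant $Z\subset X_\Gamma$ such that $\phi_p|_Z$ is injective, $\phi_p(Z)=X$, $\phi_q(Z)\subset X$ and $\varphi=\phi_q\circ(\phi_p|_Z)^{-1}$. It is essentially weakly $\mathcal P$ if there are a subshift $(X',\sigma')$, a weakly $\mathcal P$ endomorphism $\varphi'$ of it and a homeomorphism $\theta:X\to X'$ with $\theta\sigma=\sigma'\theta$, $\theta\varphi=\varphi'\theta$. An onto endomorphism $\varphi$ of a topological Markov shift $(X_G,\sigma_G)$ is $\mathcal P$ if there is a $\mathcal P$ textile system $T=(p,q:\Gamma\to G)$ such that, with $Z_T$ the set of $z\in X_\Gamma$ for which there is $(z_i)_{i\in\mathbb Z}$ in $X_\Gamma$ with $z_0=z$ and $\phi_q(z_{i-1})=\phi_p(z_i)$ for all $i$, one has $\phi_p(Z_T)=X_G$, $\phi_p|_{Z_T}$ is injective and $\varphi=\phi_q\circ(\phi_p|_{Z_T})^{-1}$. (In (2), the assertion that $(\varphi^{[^*s]})^{[t]}$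 is $\mathcal P$ includes that it is an endomorphism of a topological Markov shift.) *)

(* Defs.v *)
From HB Require Import structures.
From mathcomp Require Import all_boot all_order all_algebra.
From mathcomp Require Import all_classical.
From mathcomp Require Import topology.

Set Implicit Arguments.
Unset Strict Implicit.
Unset Printing Implicit Defensive.

Import GRing.Theory.

Local Open Scope classical_set_scope.
Local Open Scope ring_scope.

Notation conf A := (prod_topology (fun _ : int => discrete_topology A)).

Definition sigma (A : finType) (x : conf A) : conf A := fun j => x (j + 1).

Definition map_conf (A B : finType) (f : A -> B) (x : conf A) : conf B :=
  fun j => f (x j).

Definition subshift (A : finType) (X : set (conf A)) : Prop :=
  [/\ (1 < #|A|)%N, closed X & @sigma A @` X = X].

(* A map X -> X is represented by a total function on configurations, whose
   values outside X are irrelevant in everything below. *)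
Definition endomorphism (A : finType) (X : set (conf A))
    (phi : conf A -> conf A) : Prop :=
  [/\ {within X, continuous phi}, phi @` X `<=` X &
      forall x, X x -> phi (sigma x) = sigma (phi x)].

Definition onto (A : finType) (X : set (conf A)) (phi : conf A -> conf A) :
  Prop := phi @` X = X.

(* The iterate n is positive: sigma is invertible, and allowing n < 0 would
   give a strictly weaker notion on reducible Markov shifts. *)
Definition topologically_transitive (A : finType) (X : set (conf A)) : Prop :=
  forall U V : set (conf A), open U -> open V ->
    X `&` U !=set0 -> X `&` V !=set0 ->
    exists2 n : nat, (0 < n)%N &
      exists x, [/\ X x, U x & V (iter n (@sigma A) x)].

(* For t >= 1 the alphabet of X^[t] is taken to be A^t, which contains L_t(X);
   similarly A^s for the dual higher block shift. *)
Definition higher_block (A : finType) (t : nat) (x : conf A) :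
    conf (t.-tuple A) :=
  fun j => [tuple x (j + i%:Z) | i < t].

Definition dual_block (A : finType) (phi : conf A -> conf A) (s : nat)
    (x : conf A) : conf (s.-tuple A) :=
  fun j => [tuple iter i phi x j | i < s].

(* Reads off the entries of index 0; this inverts both block maps. *)
Definition first_track (A : finType) (t : nat) (t0 : (0 < t)%N)
    (y : conf (t.-tuple A)) : conf A :=
  fun j => tnth (y j) (Ordinal t0).

Lemma higher_blockK (A : finType) (t : nat) (t0 : (0 < t)%N) :
  cancel (@higher_block A t) (first_track t0).
Proof.
by move=> x; apply/funext => j; rewrite /first_track tnth_mktuple addr0.
Qed.

Lemma dual_blockK (A : finType) (phi : conf A -> conf A) (s : nat)
  (s0 : (0 < s)%N) : cancel (dual_block phi s) (first_track s0).
Proof. by move=> x; apply/funext => j; rewrite /first_track tnth_mktuple. Qed.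

Definition higher_block_shift (A : finType) (t : nat) (X : set (conf A)) :
  set (conf (t.-tuple A)) := @higher_block A t @` X.

Arguments higher_block_shift [A] t X _.

Definition higher_block_endo (A : finType) (t : nat) (t0 : (0 < t)%N)
    (phi : conf A -> conf A) : conf (t.-tuple A) -> conf (t.-tuple A) :=
  @higher_block A t \o phi \o first_track t0.

Definition dual_block_shift (A : finType) (phi : conf A -> conf A) (s : nat)
    (X : set (conf A)) : set (conf (s.-tuple A)) := dual_block phi s @` X.

Arguments dual_block_shift [A] phi s X _.

Definition dual_block_endo (A : finType) (s : nat) (s0 : (0 < s)%N)
    (phi : conf A -> conf A) : conf (s.-tuple A) -> conf (s.-tuple A) :=
  dual_block phi s \o phi \o first_track s0.

Record graph := Graph {
  arcs : finType;
  verts : finType;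
  ini : arcs -> verts;
  ter : arcs -> verts }.

Definition nondegenerate (G : graph) : Prop :=
  (forall v, exists a, @ini G a = v) /\ (forall v, exists a, @ter G a = v).

Definition edge_shift (G : graph) : set (conf (arcs G)) :=
  [set x | forall j, ter (x j) = ini (x (j + 1))].

Arguments edge_shift G _ : clear implicits.

Record graph_hom (Gamma G : graph) := GraphHom {
  hA : arcs Gamma -> arcs G;
  hV : verts Gamma -> verts G;
  hom_ini : forall a, ini (hA a) = hV (ini a);
  hom_ter : forall a, ter (hA a) = hV (ter a) }.

Definition code (Gamma G : graph) (h : graph_hom Gamma G) :
  conf (arcs Gamma) -> conf (arcs G) := map_conf (hA h).

Definition weakly_left_resolving (Gamma G : graph) (h : graph_hom Gamma G) :
    Prop :=
  forall a b : arcs Gamma, ter a = ter b -> hA h a = hA h b -> a = b.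

Definition weakly_right_resolving (Gamma G : graph) (h : graph_hom Gamma G) :
    Prop :=
  forall a b : arcs Gamma, ini a = ini b -> hA h a = hA h b -> a = b.

Definition left_resolving (Gamma G : graph) (h : graph_hom Gamma G) : Prop :=
  forall (u : verts Gamma) (a : arcs G), ter a = hV h u ->
    exists! b : arcs Gamma, hA h b = a /\ ter b = u.

Definition right_resolving (Gamma G : graph) (h : graph_hom Gamma G) : Prop :=
  forall (u : verts Gamma) (a : arcs G), ini a = hV h u ->
    exists! b : arcs Gamma, hA h b = a /\ ini b = u.

Record textile (Gamma G : graph) := Textile {
  tp : graph_hom Gamma G;
  tq : graph_hom Gamma G }.

Definition textile_property := forall Gamma G : graph, textile Gamma G -> Prop.

Definition weakly_qL : textile_property :=
  fun _ _ T => weakly_left_resolving (tq T).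
Definition weakly_qR : textile_property :=
  fun _ _ T => weakly_right_resolving (tq T).
Definition qL : textile_property := fun _ _ T => left_resolving (tq T).
Definition qR : textile_property := fun _ _ T => right_resolving (tq T).

(* [weakly_endo P X phi]: phi is an endomorphism of the subshift X presented
   by a textile system T with property P (to be used with P := weakly_qL or
   weakly_qR) and a subshift Z of X_Gamma.
   The symbols of X and the arcs of G, which are a priori unrelated finite
   sets, are compared inside a common finite set C through the injections eA
   and eG. *)
Definition weakly_endo (P : textile_property) (A : finType)
    (X : set (conf A)) (phi : conf A -> conf A) : Prop :=
  [/\ subshift X, endomorphism X phi &
  exists (Gamma G : graph) (T : textile Gamma G) (Z : set (conf (arcs Gamma)))
         (C : finType) (eA : A -> C) (eG : arcs G -> C),
    let phi_p z := map_conf eG (code (tp T) z) in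
    let phi_q z := map_conf eG (code (tq T) z) in
    [/\ P Gamma G T, injective eA, injective eG &
    [/\ closed Z, @sigma (arcs Gamma) @` Z = Z & Z `<=` edge_shift Gamma] /\
    [/\ {in Z &, injective phi_p},
        phi_p @` Z = map_conf eA @` X,
        phi_q @` Z `<=` map_conf eA @` X &
        forall x z, X x -> Z z ->
          phi_p z = map_conf eA x -> map_conf eA (phi x) = phi_q z]]].

Definition homeomorphism (A B : finType) (X : set (conf A)) (Y : set (conf B))
    (theta : conf A -> conf B) : Prop :=
  [/\ {within X, continuous theta}, set_bij X Y theta &
  exists2 eta : conf B -> conf A,
    {within Y, continuous eta} & {in X, cancel theta eta}].

Definition essentially_weakly_endo (P : textile_property) (A : finType)
    (X : set (conf A)) (phi : conf A -> conf A) : Prop :=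
  exists (B : finType) (Y : set (conf B)) (psi : conf B -> conf B)
         (theta : conf A -> conf B),
    [/\ weakly_endo P Y psi, homeomorphism X Y theta,
        forall x, X x -> theta (sigma x) = sigma (theta x) &
        forall x, X x -> theta (phi x) = psi (theta x)].

(* X = X_G, the arcs of G being the symbols of A in the image of eG. *)
Definition markov_presentation (A : finType) (X : set (conf A)) (G : graph)
    (eG : arcs G -> A) : Prop :=
  [/\ nondegenerate G, injective eG & X = map_conf eG @` edge_shift G].

Definition topological_markov_shift (A : finType) (X : set (conf A)) : Prop :=
  exists (G : graph) (eG : arcs G -> A), markov_presentation X eG.

Definition textile_base (Gamma G : graph) (T : textile Gamma G) :
    set (conf (arcs Gamma)) :=
  [set z | exists2 zs : int -> conf (arcs Gamma), zs 0 = z &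
    forall i, edge_shift Gamma (zs i) /\
              code (tq T) (zs (i - 1)) = code (tp T) (zs i)].

(* To be used with P := qL or qR. *)
Definition resolving_endo (P : textile_property) (A : finType)
    (X : set (conf A)) (phi : conf A -> conf A) : Prop :=
  [/\ endomorphism X phi, onto X phi &
  exists (G : graph) (eG : arcs G -> A), markov_presentation X eG /\
  exists (Gamma : graph) (T : textile Gamma G),
    [/\ P Gamma G T,
        code (tp T) @` textile_base T = edge_shift G,
        {in textile_base T &, injective (code (tp T))} &
        forall z, textile_base T z ->
          phi (map_conf eG (code (tp T) z)) = map_conf eG (code (tq T) z)]].

(* Main.v *)
Require Import Defs.
From mathcomp Require Import all_boot all_order all_algebra.
From mathcomp Require Import all_classical.
From mathcomp Require Import topology.
From mathcomp Require Import zify.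

(** Two constructions carry the proof.

    Staircase textile.  Let T = (p, q : Gamma -> G) present phi^s.  A point of
    the dual block shift is a column of tracks (x, phi x, ..., phi^(s-1) x),
    and phi^[*s] drops the first track and appends phi^s x.  Put the arc alpha
    of Gamma on the first track of x and keep the other s - 1 tracks c as arcs
    of G: the textile on Gamma x G^(s-1) with p'(alpha, c) = (p alpha, c) and
    q'(alpha, c) = (c, q alpha) presents phi^[*s], and q' is weakly resolving
    as soon as q is, because q' shows c entirely and shows q alpha
    ([weakly_endo_dual]).  This gives part (1), the dual block map being a
    conjugacy.

    Block textile.  Let psi be an onto endomorphism of a shift of finite type
    W, presented on Z by symbol maps p, q : Z -> W with p injective.  Then Z is
    of finite type as well ([finite_type_lift]), so for large n both Z and W
    are edge shifts of their graphs of words, with words of length n + 1 as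
    arcs, and p, q become graph-homomorphisms between them.  Every point of the
    edge shift of Z lies on a full orbit because psi is onto, so the base of
    the textile is the whole edge shift.  Weak resolvingness gives uniqueness
    of lifts of arcs; what is left is existence ([right_extendable]): if w in W
    continues the q-image of a word u of Z, then some continuation of u in Z
    has the next symbol of w as image.

    If psi is injective, then so is q on Z, and the q-preimage of w agrees with
    u on the right part of the word, since the inverse of q is local and then
    resolvingness propagates the agreement; u and this preimage can be glued
    ([right_extendable_injective]).  If Z is transitive, consider for a word of
    W the set of ends of its lifts to Z and take one where this set has least
    cardinality: there no lift can die when the word is continued, and by
    transitivity every word u of Z can be reached from such a lift
    ([right_extendable_transitive]).  The left-resolving statements follow by
    reversing the direction of the sequences.

    Part (2) combines these: a q-R presentation of phi^s is a weakly q-R one on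
    the base of its textile, the staircase turns it into a weakly q-R
    presentation of phi^[*s], and the block textile makes this q-R. *)

Set Implicit Arguments.
Unset Strict Implicit.
Unset Printing Implicit Defensive.

Import Order.TTheory GRing.Theory Num.Theory.

Local Open Scope classical_set_scope.
Local Open Scope ring_scope.

(** * Configurations and their topology *)

Lemma map_conf_inj (A B : finType) (f : A -> B) :
  injective f -> injective (map_conf f).
Proof.
move=> fi x y /(congr1 (fun u => u _)) E.
by apply/funext => j; apply: fi; apply: E.
Qed.

Lemma map_tuple_inj (A B : finType) (f : A -> B) n :
  injective f -> injective (@map_tuple n _ _ f).
Proof. by move=> fi x y /(congr1 val) /(inj_map fi) /val_inj. Qed.

(** Intervals are half-open, so that a word of length n at k is the window
    from k to k + n, and the sets [agree (- n) n] form a neighbourhood basis. *)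
Definition agree (A : Type) (a b : int) (x y : int -> A) : Prop :=
  forall j, a <= j < b -> x j = y j.

Lemma agree_sym (A : Type) a b (x y : int -> A) : agree a b x y -> agree a b y x.
Proof. by move=> H j /H. Qed.

Lemma agree_trans (A : Type) a b (y x z : int -> A) :
  agree a b x y -> agree a b y z -> agree a b x z.
Proof. by move=> H1 H2 j hj; rewrite H1 // H2. Qed.

Lemma agree_sub (A : Type) a b c d (x y : int -> A) :
  c <= a -> b <= d -> agree c d x y -> agree a b x y.
Proof. by move=> h1 h2 H j hj; apply: H; lia. Qed.

#[local] Instance nbhs_prod_filter (I : Type) (B : finType)
    (z : prod_topology (fun _ : I => discrete_topology B)) : Filter (nbhs z) :=
  @nbhs_filter (prod_topology (fun _ : I => discrete_topology B)) z.

Lemma cylinder_nbhs (I : choiceType) (B : finType)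
  (z : prod_topology (fun _ : I => discrete_topology B)) (J : seq I) :
  nbhs z [set y | forall i, i \in J -> y i = z i].
Proof.
elim: J => [|i J IH]; first by apply: filterS filterT => y _ i.
have Hi : nbhs z [set y | y i = z i].
  exact: (@proj_continuous I (fun=> discrete_topology B) i z _
    (discrete_set1 (z i : discrete_topology B))).
apply: filterS (filterI Hi IH) => y [h1 h2] k; rewrite inE => /orP[/eqP->|] //.
exact: h2.
Qed.

Definition window (n : nat) : seq int :=
  [seq i%:Z - n%:Z | i <- iota 0 (n + n)].

Lemma mem_window n j : (j \in window n) = (- n%:Z <= j < n%:Z).
Proof.
apply/mapP/idP => [[i]|H]; first by rewrite mem_iota => hi ->; lia.
by exists (absz (j + n%:Z)); [rewrite mem_iota|]; lia.
Qed.

Lemma nbhs_confP (A : finType) (x : conf A) (U : set (conf A)) :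
  nbhs x U <-> exists n : nat, forall y, agree (- n%:Z) n%:Z y x -> U y.
Proof.
split; last first.
  case=> n H; apply: filterS (cylinder_nbhs x (window n)) => y hy.
  by apply: H => j hj; apply: hy; rewrite mem_window.
pose F : set_system (conf A) :=
  [set U | exists n : nat, forall y, agree (- n%:Z) n%:Z y x -> U y].
have FF : Filter F.
  split=> [|P Q [n hn] [m hm]|P Q PQ [n hn]].
  - by exists 0.
  - exists (maxn n m) => y hy; split.
      by apply: hn; apply: agree_sub hy; lia.
    by apply: hm; apply: agree_sub hy; lia.
  - by exists n => y /hn /PQ.
suff : F --> x by apply.
apply/cvg_sup => i V; rewrite nbhsE => -[W [[C oC <-] Cx] CV].
exists (absz i).+1 => y hy; apply: CV => /=.
by rewrite hy //; lia.
Qed.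

Lemma closed_confP (A : finType) (Z : set (conf A)) :
  closed Z <-> forall z,
    (forall n : nat, exists2 y, Z y & agree (- n%:Z) n%:Z y z) -> Z z.
Proof.
split=> [cZ z H|H z cz].
  apply: cZ => U /nbhs_confP[n hn]; have [y Zy hy] := H n.
  by exists y; split => //; apply: hn.
apply: H => n.
have [|y [Zy hy]] := cz [set y | agree (- n%:Z) n%:Z y z].
  by apply/nbhs_confP; exists n.
by exists y.
Qed.

(** Continuity in terms of coordinates ([within_continuous_confP]). *)
Definition local_on (A B : finType) (X : set (conf A)) (f : conf A -> conf B) :=
  forall x, X x -> forall n : nat, exists m : nat, forall y, X y ->
    agree (- m%:Z) m%:Z y x -> agree (- n%:Z) n%:Z (f y) (f x).

Lemma within_continuous_confP (A B : finType) (X : set (conf A))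
    (f : conf A -> conf B) : {within X, continuous f} <-> local_on X f.
Proof.
split=> [/subspace_continuousP H x Xx n|H].
  have /H : X x by [].
  have : nbhs (f x) [set y | agree (- n%:Z) n%:Z y (f x)].
    by apply/nbhs_confP; exists n.
  move=> h1 h2; have := h2 _ h1.
  rewrite /= nbhs_simpl /within /= => /nbhs_confP[m hm].
  by exists m => y Xy hy; apply: hm.
apply/subspace_continuousP => x Xx U /nbhs_confP[n hn].
have [m hm] := H x Xx n.
rewrite nbhs_simpl /within /=; apply/nbhs_confP; exists m => y hy Xy.
by apply: hn; apply: hm.
Qed.

Lemma open_confP (A : finType) (U : set (conf A)) :
  open U <-> forall x, U x ->
    exists n : nat, forall y, agree (- n%:Z) n%:Z y x -> U y.
Proof.
rewrite openE; split=> H x /H; first by move/nbhs_confP.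
by move=> ?; apply/nbhs_confP.
Qed.

(** All compactness used below: it serves pairs of configurations, with int as
    index set, and orbits of configurations, with int * int. *)
Lemma cluster_seq (I : choiceType) (B : finType) (u : nat -> I -> B) :
  exists z : I -> B, forall (J : seq I) (m : nat),
    exists2 n, (m <= n)%N & forall i, i \in J -> u n i = z i.
Proof.
pose T := prod_topology (fun _ : I => discrete_topology B).
have cT : compact [set f : T | forall i, [set: discrete_topology B] (f i)].
  apply: (@tychonoff I (fun=> discrete_topology B) (fun=> setT)) => i.
  by apply: finite_compact; exact: (@finite_finset B setT).
pose F : set_system T := fun P => exists m, forall n, (m <= n)%N -> P (u n : T).
have FF : ProperFilter F.
  split=> [[m /(_ m (leqnn m))]|] //; split=> [|P Q [m hm] [k hk]|P Q PQ [m hm]].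
  - by exists 0.
  - by exists (maxn m k) => n hn; split; [apply: hm|apply: hk]; lia.
  - by exists m => n /hm /PQ.
have [|z [_ hz]] := cT F FF; first by exists 0.
exists z => J m.
have [|y [[n hn <-] hy]] := hz [set y | exists2 n, (m <= n)%N & u n = y] _ _
    (cylinder_nbhs (z : T) J).
  by exists m => n hn; exists n.
by exists n.
Qed.

(** * Shift-invariant sets, finite type and transitivity *)

Definition shift (A : finType) (k : int) (x : conf A) : conf A :=
  fun j => x (j + k).

Definition shift_invariant (A : finType) (Z : set (conf A)) : Prop :=
  forall k z, Z z -> Z (shift k z).

Lemma shift_invariantP (A : finType) (Z : set (conf A)) :
  @sigma A @` Z = Z <-> shift_invariant Z.
Proof.
split=> [E|H]; last first.
  apply/seteqP; split=> [_ [z /(H 1) Zz <-]|z Zz] //.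
  exists (shift (-1) z); first exact: H.
  by apply/funext => j; rewrite /sigma /shift; congr z; lia.
have up z : Z z -> Z (shift 1 z) by move=> Zz; rewrite -E; exists z.
have down z : Z z -> Z (shift (-1) z).
  rewrite -{1}E => -[y Zy <-]; suff -> : shift (-1) (sigma y) = y by [].
  by apply/funext => j; rewrite /sigma /shift; congr y; lia.
have nup (n : nat) z : Z z -> Z (shift n%:Z z).
  move=> Zz; elim: n => [|n IH].
    by rewrite (_ : shift _ z = z) //; apply/funext => j; rewrite /shift addr0.
  rewrite (_ : shift _ z = shift 1 (shift n z)); first exact: up.
  by apply/funext => j; rewrite /shift; congr z; lia.
have ndown (n : nat) z : Z z -> Z (shift (- n%:Z) z).
  move=> Zz; elim: n => [|n IH].
    by rewrite (_ : shift _ z = z) //; apply/funext => j; rewrite /shift addr0.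
  rewrite (_ : shift _ z = shift (-1) (shift (- n%:Z) z)); first exact: down.
  by apply/funext => j; rewrite /shift; congr z; lia.
move=> k z Zz; have [h|h] : k = `|k| \/ k = - `|k| by lia.
  by rewrite h; apply: nup.
by rewrite h; apply: ndown.
Qed.

Definition finite_type (A : finType) (N : nat) (Z : set (conf A)) : Prop :=
  forall z, (forall j : int, exists2 y, Z y & agree j (j + N%:Z) y z) -> Z z.

Lemma finite_type_leq (A : finType) (N M : nat) (Z : set (conf A)) :
  (N <= M)%N -> finite_type N Z -> finite_type M Z.
Proof.
move=> NM H z hz; apply: H => j; have [y Zy hy] := hz j.
by exists y => //; apply: agree_sub hy; lia.
Qed.

Definition glue (A : finType) (c : int) (x y : conf A) : conf A :=
  fun j => if j < c then x j else y j.

(** A window of length N that starts before b ends before c, where the glued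
    point is x; one that starts later only sees y. *)
Lemma finite_type_glue (A : finType) (N : nat) (Z : set (conf A)) (b c : int)
    (x y : conf A) :
  finite_type N Z -> Z x -> Z y -> agree b c x y -> b + N%:Z <= c ->
  Z (glue c x y).
Proof.
move=> H Zx Zy xy bc; apply: H => j; have [h|h] := lerP b j.
  exists y => // i hi; rewrite /glue; case: ltP => // hc.
  by rewrite xy //; lia.
exists x => // i hi; rewrite /glue; case: ltP => // hc.
by lia.
Qed.

(** Transitivity on cylinders, the form that lifts along symbol maps that are
    injective on a subshift. *)
Definition transitive_conf (A : finType) (Z : set (conf A)) : Prop :=
  forall (n : nat) x y, Z x -> Z y ->
    exists (k : nat) z, [/\ Z z, agree (- n%:Z) n%:Z z x
                          & agree (- n%:Z) n%:Z (shift k%:Z z) y].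

Lemma iter_sigma (A : finType) (n : nat) (x : conf A) :
  iter n (@sigma A) x = shift n%:Z x.
Proof.
elim: n => [|n IH]; first by apply/funext => j; rewrite /shift addr0.
by rewrite iterS IH; apply/funext => j; rewrite /sigma /shift; congr x; lia.
Qed.

Lemma topologically_transitive_conf (A : finType) (X : set (conf A)) :
  topologically_transitive X -> transitive_conf X.
Proof.
move=> H n x y Xx Xy.
have oC (u : conf A) : open ([set v | agree (- n%:Z) n%:Z v u] : set (conf A)).
  apply/open_confP => v hv; exists n => w hw; exact: agree_trans hw hv.
have [||k _ [z [Xz zx zy]]] := H _ _ (oC x) (oC y).
- by exists x.
- by exists y.
by exists k, z; split => //; rewrite -iter_sigma.
Qed.

Lemma closed_mem_limit (A : finType) (Z : set (conf A)) (u : nat -> conf A)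
    (z : conf A) :
  closed Z -> (forall n, Z (u n)) ->
  (forall n : nat, exists m, agree (- n%:Z) n%:Z (u m) z) -> Z z.
Proof.
move=> /closed_confP H Zu hu; apply: H => n; have [m hm] := hu n.
by exists (u m).
Qed.

(** The inverse of an injective code on a compact set is a sliding block code.
    Otherwise there are pairs of points whose images agree on longer and longer
    windows but which differ at 0; they accumulate at a pair of distinct points
    with the same image. *)
Lemma inverse_window (B A : finType) (f : B -> A) (Z : set (conf B)) :
  closed Z -> shift_invariant Z -> {in Z &, injective (map_conf f)} ->
  exists r : nat, forall z y, Z z -> Z y -> forall j,
    agree (j - r%:Z) (j + r%:Z) (map_conf f z) (map_conf f y) -> z j = y j.
Proof.
move=> cZ sZ inj.
have [H|] := pselect (exists r : nat, forall z y, Z z -> Z y ->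
    agree (- r%:Z) r%:Z (map_conf f z) (map_conf f y) -> z 0 = y 0).
  have [r hr] := H; exists r => z y Zz Zy j hj.
  have := hr _ _ (sZ j _ Zz) (sZ j _ Zy).
  rewrite /shift add0r; apply => i hi.
  by apply: (hj (i + j)); lia.
move=> /forallNP H; exfalso.
have /choice[u hu] : forall r : nat, exists p : conf B * conf B,
    [/\ Z p.1, Z p.2, agree (- r%:Z) r%:Z (map_conf f p.1) (map_conf f p.2)
      & p.1 0 <> p.2 0].
  move=> r; have := H r.
  move=> /existsNP[z /existsNP[y]].
  rewrite !not_implyE => -[Zz [Zy [h1 h2]]].
  by exists (z, y).
have [z hz] := cluster_seq (fun n j => ((u n).1 j, (u n).2 j)).
have hz1 (n : nat) : exists m, [/\ (n <= m)%N,
       agree (- n%:Z) n%:Z (u m).1 (fun j => (z j).1)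
     & agree (- n%:Z) n%:Z (u m).2 (fun j => (z j).2)].
  have [m nm hm] := hz (window n) n; exists m.
  by split=> // j hj; rewrite -hm ?mem_window.
have Z1 : Z (fun j => (z j).1).
  apply: (closed_mem_limit (u := fun n => (u n).1)) => // [n|n].
    by case: (hu n).
  by have [m [_ h _]] := hz1 n; exists m.
have Z2 : Z (fun j => (z j).2).
  apply: (closed_mem_limit (u := fun n => (u n).2)) => // [n|n].
    by case: (hu n).
  by have [m [_ _ h]] := hz1 n; exists m.
have [m [m1 h1 h2]] := hz1 1%N.
have [_ _ _] := hu m; rewrite h1 // h2 //; apply.
suff : (fun j => (z j).1) = (fun j => (z j).2) by move=> /(congr1 (@^~ 0)).
apply: inj; rewrite ?inE //; apply/funext => j; rewrite /map_conf.
have [k [mk k1 k2]] := hz1 (absz j).+1.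
have hj : - ((absz j).+1)%:Z <= j < ((absz j).+1)%:Z by lia.
have [_ _ e _] := hu k; rewrite -(k1 j hj) -(k2 j hj); apply: (e j); lia.
Qed.

Section injective_code.
Variables (B A : finType) (f : B -> A) (Z : set (conf B)) (W : set (conf A)).
Hypotheses (cZ : closed Z) (sZ : shift_invariant Z)
  (inj : {in Z &, injective (map_conf f)}) (ZW : map_conf f @` Z = W).

(** If the words of z occur in Z, then the image of z is in W, hence is the
    image of some y in Z; near each coordinate z coincides with a point of Z
    that has the same image as y there, so the inverse code identifies z and
    y. *)
Lemma finite_type_lift N : finite_type N W -> exists M, finite_type M Z.
Proof.
move=> ftW; have [r hr] := inverse_window cZ sZ inj.
exists (maxn N (r + r).+1) => z hz.
have [y Zy fy] : exists2 y, Z y & map_conf f y = map_conf f z.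
  suff : W (map_conf f z) by rewrite -ZW => -[y Zy yz]; exists y.
  apply: ftW => j; have [y Zy hy] := hz j; exists (map_conf f y).
    by rewrite -ZW; exists y.
  by move=> i hi; rewrite /map_conf hy //; lia.
suff -> : z = y by [].
apply/funext => j; have [y' Zy' hy'] := hz (j - r%:Z).
rewrite -hy'; last by lia.
apply: hr => //; rewrite fy => i hi; rewrite /map_conf hy' //; lia.
Qed.

Lemma transitive_lift : transitive_conf W -> transitive_conf Z.
Proof.
move=> tW n x y Zx Zy; have [r hr] := inverse_window cZ sZ inj.
have fW z : Z z -> W (map_conf f z) by move=> Zz; rewrite -ZW; exists z.
have [k [w [Ww wx wy]]] := tW (n + r)%N _ _ (fW _ Zx) (fW _ Zy).
move: Ww; rewrite -ZW => -[z Zz zw]; subst w.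
exists k, z; split=> // j hj; apply: hr => //.
- by apply: agree_sub wx; lia.
- exact: sZ.
- by apply: agree_sub wy; lia.
Qed.
End injective_code.

(** * Existence of lifts of one-symbol extensions *)

(** The trace on Z of weak right-resolvingness of q.  Being a statement about
    points, it can be reversed and does not refer to vertices. *)
Definition right_deterministic (B A : finType) (q : B -> A) (Z : set (conf B)) :=
  forall z y, Z z -> Z y -> forall j, z j = y j ->
    q (z (j + 1)) = q (y (j + 1)) -> z (j + 1) = y (j + 1).

Definition left_deterministic (B A : finType) (q : B -> A) (Z : set (conf B)) :=
  forall z y, Z z -> Z y -> forall j, z (j + 1) = y (j + 1) ->
    q (z j) = q (y j) -> z j = y j.

(** The existence half of right-resolvingness for words of length n. *)
Definition right_extendable (B A : finType) (q : B -> A) (n : nat)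
    (Z : set (conf B)) (W : set (conf A)) :=
  forall z w, Z z -> W w -> agree 0 n%:Z (map_conf q z) w ->
    exists y, [/\ Z y, agree 0 n%:Z y z & q (y n%:Z) = w n%:Z].

Definition left_extendable (B A : finType) (q : B -> A) (n : nat)
    (Z : set (conf B)) (W : set (conf A)) :=
  forall z w, Z z -> W w -> agree 1 (n%:Z + 1) (map_conf q z) w ->
    exists y, [/\ Z y, agree 1 (n%:Z + 1) y z & q (y 0) = w 0].

Lemma higher_block_eqP (A : finType) n k (x y : conf A) :
  higher_block n x k = higher_block n y k <-> agree k (k + n%:Z) x y.
Proof.
split=> [E j hj|H].
  have hi : (absz (j - k) < n)%N by lia.
  have /(congr1 (fun t => tnth t (Ordinal hi))) := E.
  by rewrite !tnth_mktuple /= (_ : k + _ = j) //; lia.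
by apply: eq_from_tnth => i; rewrite !tnth_mktuple H //; have := ltn_ord i; lia.
Qed.

Section right_extension.
Variables (B A : finType) (q : B -> A) (Z : set (conf B)) (W : set (conf A)).
Hypotheses (sZ : shift_invariant Z) (sW : shift_invariant W)
  (qZ : map_conf q @` Z = W) (detq : right_deterministic q Z).

Lemma right_deterministic_run z y (k m : int) : Z z -> Z y -> z k = y k ->
  agree (k + 1) m (map_conf q z) (map_conf q y) -> agree k m z y.
Proof.
move=> Zz Zy zyk H j hj.
have [n jn] : exists n : nat, j = k + n%:Z by exists (absz (j - k)); lia.
subst j; elim: n hj => [|n IH] hj; first by rewrite addr0.
rewrite (_ : k + n.+1%:Z = k + n%:Z + 1); last by lia.
by apply: detq => //; [apply: IH; lia|apply: (H (k + n%:Z + 1)); lia].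
Qed.

(** The q-preimage y of w agrees with z at coordinate r by locality of the
    inverse of q, hence by determinism up to n, and the two can be glued. *)
Lemma right_extendable_injective M : finite_type M Z -> closed Z ->
  {in Z &, injective (map_conf q)} ->
  exists n0 : nat, forall n : nat, (n0 <= n)%N -> right_extendable q n Z W.
Proof.
move=> ftZ cZ inj; have [r hr] := inverse_window cZ sZ inj.
(* Coordinate r needs r symbols on either side inside [0, n), and the overlap
   [r, n) must contain M symbols for the gluing. *)
exists (M + r + r).+1 => n hn z w Zz; rewrite -{1}qZ => -[y Zy <-{w}] hzy.
have zyr : z r%:Z = y r%:Z by apply: hr => // j hj; apply: hzy; lia.
have zy : agree r%:Z n%:Z z y.
  by apply: right_deterministic_run => // j hj; apply: hzy; lia.
exists (glue n%:Z z y); split.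
- by apply: (finite_type_glue ftZ Zz Zy zy); lia.
- by move=> j hj; rewrite /glue; case: ltP => //; lia.
- by rewrite /glue ltxx.
Qed.

(** The final n-words of the lifts to Z of the word of w on [-(n + k), 0).
    Whole words rather than last symbols are recorded, because the extension
    obtained in [lift_from_minimal] must agree with the given lift on one. *)
Definition end_states (n k : nat) (w : conf A) : {set n.-tuple B} :=
  [set u | `[< exists z, [/\ Z z, agree (- (n + k)%:Z) 0 (map_conf q z) w
                           & u = higher_block n z (- n%:Z)] >]]%SET.

Lemma end_statesP n k w u : reflect (exists z, [/\ Z z,
    agree (- (n + k)%:Z) 0 (map_conf q z) w & u = higher_block n z (- n%:Z)])
  (u \in end_states n k w).
Proof. by rewrite inE; apply: asboolP. Qed.

Lemma minimal_end_states n : W !=set0 ->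
  exists (k : nat) w, W w /\ forall l v, W v ->
    (#|end_states n k w| <= #|end_states n l v|)%N.
Proof.
move=> [w0 Ww0].
pose P m := `[< exists k w, W w /\ #|end_states n k w| = m >].
have exP : exists m, P m.
  by exists #|end_states n 0 w0|; apply/asboolP; exists 0, w0.
case: (ex_minnP exP) => m /asboolP[k [w [Ww <-]]] hmin.
by exists k, w; split=> // l v Wv; apply: hmin; apply/asboolP; exists l, v.
Qed.

(** Each final word of a lift of a longer word comes from a final word at 0,
    and this correspondence is injective by determinism.  By minimality it is
    onto, so every lift of the minimal word extends to lifts of all its
    continuations v. *)
Lemma lift_from_minimal n k w z v (m : nat) : (0 < n)%N ->
  (forall l v, W v -> (#|end_states n k w| <= #|end_states n l v|)%N) ->
  W v -> Z z -> agree (- (n + k)%:Z) 0 (map_conf q z) w ->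
  agree (- (n + k)%:Z) 0 v w ->
  exists y, [/\ Z y, agree (- n%:Z) 0 y z
    & agree (- n%:Z) m%:Z (map_conf q y) v].
Proof.
move=> n0 hmin Wv Zz zw vw.
(* Shifted by m, the word of v on [-(n + k), m) ends at 0. *)
pose v' := shift m%:Z v; pose E := end_states n (k + m) v'.
have /choice[g hg] : forall e, exists y : conf B, e \in E ->
    [/\ Z y, agree (- (n + k)%:Z) m%:Z (map_conf q y) v & e = higher_block n y (m%:Z - n%:Z)].
  move=> e; have [/end_statesP[y [Zy yv ->]]|_] := boolP (e \in E); last by exists z.
  exists (shift (- m%:Z) y) => _; split; first exact: sZ.
    move=> j hj; have := yv (j - m%:Z); rewrite /v' /shift subrK; apply; lia.
  by apply: eq_from_tnth => i; rewrite !tnth_mktuple /shift; congr y; lia.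
pose f e := higher_block n (g e) (- n%:Z).
have finj : {in E &, injective f}.
  move=> a b aE bE /higher_block_eqP; rewrite addrC subrr => hab.
  have [Za av ->] := hg a aE; have [Zb bv ->] := hg b bE.
  apply/higher_block_eqP; rewrite addrNK.
  have H : agree (-1) m%:Z (g a) (g b).
    apply: right_deterministic_run => //; first by apply: hab; lia.
    by move=> j hj; rewrite av ?bv //; lia.
  move=> j hj; have [h|h] := ltrP j (-1); first by apply: hab; lia.
  by apply: H; lia.
have sub : f @: E \subset end_states n k w.
  apply/fintype.subsetP => _ /imsetP[e eE ->]; apply/end_statesP; exists (g e).
  have [Ze ev _] := hg e eE; split=> // j hj; rewrite ev ?vw //; lia.
have EE : f @: E = end_states n k w.
  apply/eqP; rewrite eqEcard sub card_in_imset //.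
  by apply: hmin; apply: sW.
have : higher_block n z (- n%:Z) \in f @: E by rewrite EE; apply/end_statesP; exists z.
move=> /imsetP[e eE /higher_block_eqP]; rewrite addrC subrr => ze.
have [Ze ev _] := hg e eE; exists (g e); split=> //.
  exact: agree_sym.
by apply: agree_sub ev; lia.
Qed.

(** Transitivity provides y in Z that starts as a lift of a minimal word and
    later shows the given word of z.  Splicing w onto the image of y gives a
    continuation of the minimal word, so it lifts from y; by determinism the
    lift follows y until the end of the word of z. *)
Lemma right_extendable_transitive N : finite_type N W -> transitive_conf Z ->
  exists n0 : nat, forall n : nat, (n0 <= n)%N -> right_extendable q n Z W.
Proof.
move=> ftW tZ.
(* N symbols allow the splicing in W; one symbol starts the determinism. *)
exists N.+1 => n hn z w Zz Ww zw.
have [k [w0 [Ww0 hmin]]] : exists (k : nat) w, W w /\ forall l v, W v ->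
    (#|end_states n k w| <= #|end_states n l v|)%N.
  by apply: minimal_end_states; exists w.
move: (Ww0); rewrite -{1}qZ => -[z0 Zz0 z0w0].
have [m [y [Zy yz0 yz]]] := tZ (n + k)%N _ _ Zz0 Zz.
have Wqy : W (map_conf q y) by rewrite -qZ; exists y.
pose v := glue (m + n)%:Z (map_conf q y) (shift (- m%:Z) w).
have yw : agree m%:Z (m + n)%:Z (map_conf q y) (shift (- m%:Z) w).
  move=> j hj; rewrite /shift -zw /map_conf; last by lia.
  by rewrite -yz /shift ?addrNK //; lia.
have Wv : W v by apply: (finite_type_glue ftW Wqy (sW _ Ww) yw); lia.
have vy : agree (- (n + k)%:Z) (m + n)%:Z v (map_conf q y).
  by move=> j hj; rewrite /v /glue; case: ltP => //; lia.
have yw0 : agree (- (n + k)%:Z) 0 (map_conf q y) w0.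
  by move=> j hj; rewrite -z0w0 /map_conf yz0 //; lia.
have [||x [Zx xy xv]] :=
  @lift_from_minimal n k w0 y v (m + n).+1 _ hmin Wv Zy yw0.
- by lia.
- by move=> j hj; rewrite vy ?yw0 //; lia.
have xy' : agree (-1) (m + n)%:Z x y.
  apply: right_deterministic_run => //; first by apply: xy; lia.
  by move=> j hj; rewrite xv ?vy //; lia.
exists (shift m%:Z x); split; first exact: sZ.
  move=> j hj; rewrite /shift xy'; last by lia.
  by apply: (yz j); lia.
rewrite /shift; have := xv (n%:Z + m%:Z); rewrite /map_conf => ->; last by lia.
by rewrite /v /glue; case: ltP => [|_]; [lia|rewrite /shift addrK].
Qed.

End right_extension.

(** Reversing sequences exchanges left and right. *)
Definition flip (A : finType) (x : conf A) : conf A := fun j => x (- j).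

Lemma flipK (A : finType) : involutive (@flip A).
Proof. by move=> x; apply/funext => j; rewrite /flip opprK. Qed.

Definition flips (A : finType) (Z : set (conf A)) : set (conf A) :=
  [set z | Z (flip z)].

Lemma flips_shift (A : finType) (Z : set (conf A)) :
  shift_invariant Z -> shift_invariant (flips Z).
Proof.
move=> sZ k z; rewrite /flips /= => /(sZ (- k)); congr Z.
by apply/funext => j; rewrite /flip /shift; congr z; lia.
Qed.

Lemma flips_finite_type (A : finType) N (Z : set (conf A)) :
  finite_type N Z -> finite_type N (flips Z).
Proof.
move=> H z hz; apply: H => j; have [y Zy hy] := hz (1 - j - N%:Z).
by exists (flip y) => // i hi; rewrite /flip hy //; lia.
Qed.

Lemma flips_closed (A : finType) (Z : set (conf A)) : closed Z -> closed (flips Z).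
Proof.
move=> /closed_confP H; apply/closed_confP => z hz; apply: H => n.
have [y Zy hy] := hz n.+1; exists (flip y) => // j hj.
by rewrite /flip hy //; lia.
Qed.

Lemma flips_transitive (A : finType) (Z : set (conf A)) :
  shift_invariant Z -> transitive_conf Z -> transitive_conf (flips Z).
Proof.
move=> sZ tZ n x y Zx Zy; have [k [z [Zz zy zx]]] := tZ n.+1 _ _ Zy Zx.
exists k, (flip (shift k%:Z z)); split.
- by rewrite /flips /= flipK; apply: sZ.
- by move=> j hj; rewrite /flip zx /flip ?opprK //; lia.
- move=> j hj; have := zy (- j); rewrite /flip /shift opprK => <-; last by lia.
  by congr z; lia.
Qed.

Lemma flips_image (B A : finType) (q : B -> A) (Z : set (conf B)) :
  map_conf q @` flips Z = flips (map_conf q @` Z).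
Proof.
apply/seteqP; split=> [_ [z Zz <-]|w [z Zz zw]]; first by exists (flip z).
exists (flip z); first by rewrite /flips /= flipK.
by rewrite -[w]flipK -zw.
Qed.

Lemma flips_injective (B A : finType) (q : B -> A) (Z : set (conf B)) :
  {in Z &, injective (map_conf q)} -> {in flips Z &, injective (map_conf q)}.
Proof.
move=> inj x y; rewrite !inE => Zx Zy xy.
by apply: (can_inj (@flipK B)); apply: inj; rewrite ?inE //;
  apply: (congr1 (@flip A) xy).
Qed.

Lemma flips_deterministic (B A : finType) (q : B -> A) (Z : set (conf B)) :
  left_deterministic q Z -> right_deterministic q (flips Z).
Proof.
move=> H z y Zz Zy j zy qzy; have := H _ _ Zz Zy (- (j + 1)).
rewrite /flip (_ : - (- (j + 1) + 1) = j); last by lia.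
by rewrite opprK; apply.
Qed.

Lemma flips_extendable (B A : finType) (q : B -> A) n (Z : set (conf B))
    (W : set (conf A)) :
  shift_invariant Z -> shift_invariant W ->
  right_extendable q n (flips Z) (flips W) -> left_extendable q n Z W.
Proof.
move=> sZ sW H z w Zz Ww zw.
have refl_in (C : finType) (Y : set (conf C)) x : shift_invariant Y -> Y x ->
    flips Y (fun j => x (n%:Z - j)).
  move=> sY Yx; have := sY n%:Z _ Yx; rewrite /flips /=; congr Y.
  by apply/funext => j; rewrite /flip /shift; congr x; lia.
have [|y [Zy yz yw]] := H _ _ (refl_in _ _ _ sZ Zz) (refl_in _ _ _ sW Ww).
  by move=> j hj; apply: zw; lia.
exists (fun j => y (n%:Z - j)); split.
- have := refl_in _ _ _ (flips_shift sZ) Zy; rewrite /flips /=; congr Z.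
  by apply/funext => j; rewrite /flip opprK.
- by move=> j hj; rewrite yz; [congr z|]; lia.
- by rewrite subr0 yw subrr.
Qed.

Section extension.
Variables (B A : finType) (q : B -> A) (Z : set (conf B)) (W : set (conf A)).
Variables (M N : nat).
Hypotheses (cZ : closed Z) (sZ : shift_invariant Z) (sW : shift_invariant W)
  (qZ : map_conf q @` Z = W) (ftZ : finite_type M Z) (ftW : finite_type N W)
  (H : {in Z &, injective (map_conf q)} \/ transitive_conf Z).

Lemma eventually_right_extendable : right_deterministic q Z ->
  exists n0 : nat, forall n : nat, (n0 <= n)%N -> right_extendable q n Z W.
Proof.
move=> det; case: H => [inj|tZ].
  exact: right_extendable_injective ftZ cZ inj.
exact: right_extendable_transitive ftW tZ.
Qed.
End extension.

Lemma eventually_left_extendable (B A : finType) (q : B -> A) (Z : set (conf B))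
    (W : set (conf A)) M N : closed Z -> shift_invariant Z -> shift_invariant W ->
  map_conf q @` Z = W -> finite_type M Z -> finite_type N W ->
  {in Z &, injective (map_conf q)} \/ transitive_conf Z ->
  left_deterministic q Z ->
  exists n0 : nat, forall n : nat, (n0 <= n)%N -> left_extendable q n Z W.
Proof.
move=> cZ sZ sW qZ ftZ ftW H det.
have qF : map_conf q @` flips Z = flips W by rewrite flips_image qZ.
have HF : {in flips Z &, injective (map_conf q)} \/ transitive_conf (flips Z).
  by case: H => [/flips_injective|/(flips_transitive sZ)]; [left|right].
have [n0 hn0] := eventually_right_extendable (flips_closed cZ) (flips_shift sZ)
  (flips_shift sW) qF (flips_finite_type ftZ) (flips_finite_type ftW) HF
  (flips_deterministic det).
by exists n0 => n /hn0; apply: flips_extendable.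
Qed.

Lemma higher_block0_shift (A : finType) n k (x : conf A) :
  higher_block n (shift k x) 0 = higher_block n x k.
Proof. by apply: eq_from_tnth => i; rewrite !tnth_mktuple /shift; congr x; lia. Qed.

Lemma map_higher_block (B A : finType) (f : B -> A) n k (z : conf B) :
  map_tuple f (higher_block n z k) = higher_block n (map_conf f z) k.
Proof. by apply: eq_from_tnth => i; rewrite tnth_map !tnth_mktuple. Qed.

(** * Conjugacies and higher blocks *)

Section conjugation.
Variables (A B : finType) (X : set (conf A)).
Variables (theta : conf A -> conf B) (eta : conf B -> conf A).
Hypotheses (thetaK : cancel theta eta) (ltheta : local_on X theta)
  (leta : local_on (theta @` X) eta)
  (stheta : forall x, X x -> theta (sigma x) = sigma (theta x)).
Variable phi : conf A -> conf A.

Lemma conjugate_endomorphism : endomorphism X phi ->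
  endomorphism (theta @` X) (theta \o phi \o eta).
Proof.
case=> /within_continuous_confP lphi sub comm.
have Xphi x : X x -> X (phi x) by move=> Xx; apply: sub; exists x.
split.
- apply/within_continuous_confP => y Yy n; have [x Xx xy] := Yy; subst y.
  have [m hm] := ltheta (Xphi x Xx) n.
  have [k hk] := lphi x Xx m.
  have [l hl] := leta Yy k.
  exists l => _ [x' Xx' <-] h /=; rewrite !thetaK.
  apply: hm; first exact: Xphi.
  apply: hk => //.
  by have := hl (theta x'); rewrite !thetaK; apply => //; exists x'.
- by move=> _ [_ [x Xx <-] <-] /=; rewrite thetaK; exists (phi x) => //; apply: Xphi.
- move=> _ [x Xx <-] /=; rewrite -stheta // !thetaK comm // stheta //.
  exact: Xphi.
Qed.

Lemma conjugate_onto : onto X phi -> onto (theta @` X) (theta \o phi \o eta).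
Proof.
move=> onphi; apply/seteqP; split=> [_ [_ [x Xx <-] <-]|_ [x Xx <-]] /=.
  by rewrite thetaK; exists (phi x) => //; rewrite -onphi; exists x.
move: Xx; rewrite -{1}onphi => -[x' Xx' <-].
by exists (theta x'); [exists x'|rewrite /= thetaK].
Qed.

End conjugation.

Lemma local_first_track (A : finType) t (t0 : (0 < t)%N) Y :
  local_on Y (@first_track A t t0).
Proof. by move=> x _ n; exists n => y _ h j hj; rewrite /first_track h. Qed.

Lemma local_higher_block (A : finType) t X : local_on X (@higher_block A t).
Proof.
move=> x _ n; exists (n + t)%N => y _ h j hj.
by apply/higher_block_eqP => i hi; apply: h; lia.
Qed.

Lemma higher_block_sigma (A : finType) t (x : conf A) :
  higher_block t (sigma x) = sigma (higher_block t x).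
Proof.
apply/funext => j; apply: eq_from_tnth => i.
by rewrite !tnth_mktuple /sigma; congr x; lia.
Qed.

(** * Graphs of words *)

Section block_graph.
Variables (n : nat) (B : finType) (Z : set (conf B)).
Hypothesis sZ : shift_invariant Z.

Definition occurs m : pred (m.-tuple B) :=
  fun u => `[< exists2 z, Z z & u = higher_block m z 0 >].

Lemma occurs_block m z k : Z z -> occurs (higher_block m z k).
Proof.
by move=> Zz; apply/asboolP; exists (shift k z); [apply: sZ|rewrite higher_block0_shift].
Qed.

Lemma occursE m k (u : m.-tuple B) : occurs u ->
  exists2 z, Z z & u = higher_block m z k.
Proof.
move=> /asboolP[z Zz ->]; exists (shift (- k) z); first exact: sZ.
by apply: eq_from_tnth => i; rewrite !tnth_mktuple /shift; congr z; lia.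
Qed.

Definition init_word (u : n.+1.-tuple B) : n.-tuple B :=
  [tuple tnth u (widen_ord (leqnSn n) i) | i < n].

Definition tail_word (u : n.+1.-tuple B) : n.-tuple B :=
  [tuple tnth u (lift ord0 i) | i < n].

Lemma init_higher_block z k : init_word (higher_block n.+1 z k) = higher_block n z k.
Proof. by apply: eq_from_tnth => i; rewrite !tnth_mktuple. Qed.

Lemma tail_higher_block z k :
  tail_word (higher_block n.+1 z k) = higher_block n z (k + 1).
Proof.
by apply: eq_from_tnth => i; rewrite !tnth_mktuple /= /bump /=; congr z; lia.
Qed.

Lemma occurs_init u : occurs u -> occurs (init_word u).
Proof. by move=> /(occursE 0)[z Zz ->]; rewrite init_higher_block occurs_block. Qed.

Lemma occurs_tail u : occurs u -> occurs (tail_word u).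
Proof. by move=> /(occursE 0)[z Zz ->]; rewrite tail_higher_block occurs_block. Qed.

Definition block_graph : graph := @Graph
  {u : n.+1.-tuple B | occurs u} {u : n.-tuple B | occurs u}
  (fun a => exist _ (init_word (val a)) (occurs_init (valP a)))
  (fun a => exist _ (tail_word (val a)) (occurs_tail (valP a))).

Definition block_path z (Zz : Z z) : conf (arcs block_graph) :=
  fun j => exist _ (higher_block n.+1 z j) (occurs_block n.+1 j Zz).

Lemma block_pathP z (Zz : Z z) : edge_shift block_graph (block_path Zz).
Proof. by move=> j; apply: val_inj; rewrite /= tail_higher_block init_higher_block. Qed.

(** A path consists of overlapping words of Z, hence is read off from the
    configuration of their first symbols, all of whose words of length n + 1
    occur in Z. *)
Lemma edge_shift_block_graph x : finite_type n.+1 Z ->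
  edge_shift block_graph x ->
  exists2 z, Z z & forall j, val (x j) = higher_block n.+1 z j.
Proof.
move=> ftZ ex; pose z : conf B := fun j => tnth (val (x j)) ord0.
have xz j : val (x j) = higher_block n.+1 z j.
  apply: eq_from_tnth => i; rewrite tnth_mktuple /z.
  case: i => i; elim: i j => [|i IH] j hi; rewrite ?addr0.
    by congr tnth; apply: val_inj.
  have hi' : (i < n.+1)%N by lia.
  have := IH (j + 1) hi'; rewrite /= (_ : j + 1 + i%:Z = j + i.+1%:Z); last by lia.
  move=> <-; have hi2 : (i < n)%N by [].
  have /(congr1 (fun u => tnth (val u) (Ordinal hi2))) := ex j.
  rewrite /= !tnth_mktuple => E.
  transitivity (tnth (val (x j)) (lift ord0 (Ordinal hi2))).
    by congr tnth; apply: val_inj.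
  by rewrite E; congr tnth; apply: val_inj.
exists z => //; apply: ftZ => j; have [y Zy hy] := occursE j (valP (x j)).
exists y => //; apply/higher_block_eqP; rewrite -xz; exact/esym.
Qed.

Lemma block_graph_nondegenerate : Defs.nondegenerate block_graph.
Proof.
split=> v; have /(occursE 0)[z Zz vz] := valP v.
  exists (block_path Zz 0); apply: val_inj => /=.
  by rewrite init_higher_block -vz.
exists (block_path Zz (- 1)); apply: val_inj => /=.
by rewrite tail_higher_block (_ : -1 + 1 = 0) // -vz.
Qed.

Lemma block_graph_presentation : finite_type n.+1 Z ->
  @markov_presentation (n.+1.-tuple B) (higher_block_shift n.+1 Z) block_graph val.
Proof.
move=> ftZ; split; [exact: block_graph_nondegenerate|exact: val_inj|].
apply/seteqP; split=> [_ [z Zz <-]|_ [x ex <-]].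
  by exists (block_path Zz) => //; apply: block_pathP.
have [z Zz xz] := edge_shift_block_graph ftZ ex; exists z => //.
by apply/funext => j; rewrite /map_conf xz.
Qed.

End block_graph.

Section block_hom.
Variables (n : nat) (B A : finType) (Z : set (conf B)) (W : set (conf A)).
Hypotheses (sZ : shift_invariant Z) (sW : shift_invariant W).
Variables (f : B -> A) (fZ : forall z, Z z -> W (map_conf f z)).

Lemma occurs_map m (u : m.-tuple B) : occurs Z u -> occurs W (map_tuple f u).
Proof.
move=> /(occursE sZ 0)[z Zz ->]; rewrite map_higher_block.
by apply: occurs_block => //; apply: fZ.
Qed.

Definition block_hom_arc (a : arcs (block_graph n sZ)) : arcs (block_graph n sW) :=
  exist _ (map_tuple f (val a)) (occurs_map (valP a)).

Definition block_hom_vert (a : verts (block_graph n sZ)) : verts (block_graph n sW) :=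
  exist _ (map_tuple f (val a)) (occurs_map (valP a)).

Lemma block_hom_ini a : ini (block_hom_arc a) = block_hom_vert (ini a).
Proof.
apply: val_inj => /=; apply: eq_from_tnth => i.
by rewrite tnth_mktuple !tnth_map tnth_ord_tuple.
Qed.

Lemma block_hom_ter a : ter (block_hom_arc a) = block_hom_vert (ter a).
Proof.
apply: val_inj => /=; apply: eq_from_tnth => i.
by rewrite tnth_mktuple !tnth_map tnth_ord_tuple.
Qed.

Definition block_hom : graph_hom (block_graph n sZ) (block_graph n sW) :=
  GraphHom block_hom_ini block_hom_ter.

Lemma block_hom_path z (x : conf (arcs (block_graph n sZ))) :
  (forall j, val (x j) = higher_block n.+1 z j) ->
  map_conf val (code block_hom x) = higher_block n.+1 (map_conf f z).
Proof.
by move=> xz; apply/funext => j; rewrite /map_conf /code /= xz map_higher_block.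
Qed.

Lemma block_hom_edge x : edge_shift (block_graph n sZ) x ->
  edge_shift (block_graph n sW) (code block_hom x).
Proof.
by move=> ex j; rewrite (hom_ter block_hom) (hom_ini block_hom) ex.
Qed.

(** Extendability gives a lift of each arc; determinism, which needs a
    preceding symbol and thus n > 0, gives its uniqueness. *)
Lemma block_hom_right_resolving : (0 < n)%N -> right_deterministic f Z ->
  right_extendable f n Z W -> right_resolving block_hom.
Proof.
move=> n0 det ext u a /(congr1 val) /=.
have /(occursE sZ 0)[z Zz uz] := valP u; have /(occursE sW 0)[w Ww aw] := valP a.
rewrite aw uz init_higher_block map_higher_block => /higher_block_eqP.
rewrite add0r => wz.
have [y [Zy yz yw]] := ext z w Zz Ww (agree_sym wz).
have fy : higher_block n.+1 (map_conf f y) 0 = higher_block n.+1 w 0.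
  apply/higher_block_eqP => j hj; have [h|h] := ltrP j n%:Z.
    by rewrite wz /map_conf ?yz //; lia.
  by rewrite (_ : j = n%:Z) //; lia.
exists (block_path n sZ Zy 0); split.
  split; apply: val_inj => /=; first by rewrite map_higher_block fy -aw.
  by rewrite init_higher_block uz; apply/higher_block_eqP; rewrite add0r.
move=> b [/(congr1 val) /= ba /(congr1 val) /= bu]; apply: val_inj => /=.
have /(occursE sZ 0)[x Zx bx] := valP b.
move: ba bu; rewrite bx aw -fy uz !map_higher_block init_higher_block.
move=> /higher_block_eqP xw /higher_block_eqP xz; apply/higher_block_eqP => j hj.
have [h|h] := ltrP j n%:Z; first by rewrite yz ?xz //; lia.
rewrite (_ : j = n%:Z - 1 + 1); last by lia.
apply: det => //; first by rewrite yz ?xz //; lia.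
by apply/esym; apply: (xw (n%:Z - 1 + 1)); lia.
Qed.

Lemma block_hom_left_resolving : (0 < n)%N -> left_deterministic f Z ->
  left_extendable f n Z W -> left_resolving block_hom.
Proof.
move=> n0 det ext u a /(congr1 val) /=.
have /(occursE sZ 1)[z Zz uz] := valP u; have /(occursE sW 0)[w Ww aw] := valP a.
rewrite aw uz tail_higher_block map_higher_block add0r => /higher_block_eqP.
rewrite addrC => wz.
have [y [Zy yz yw]] := ext z w Zz Ww (agree_sym wz).
have fy : higher_block n.+1 (map_conf f y) 0 = higher_block n.+1 w 0.
  apply/higher_block_eqP => j hj; have [h|h] := ltrP 0 j.
    by rewrite wz /map_conf ?yz //; lia.
  by rewrite (_ : j = 0) //; lia.
exists (block_path n sZ Zy 0); split.
  split; apply: val_inj => /=; first by rewrite map_higher_block fy -aw.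
  by rewrite tail_higher_block uz; apply/higher_block_eqP; rewrite add0r addrC.
move=> b [/(congr1 val) /= ba /(congr1 val) /= bu]; apply: val_inj => /=.
have /(occursE sZ 0)[x Zx bx] := valP b.
move: ba bu; rewrite bx aw -fy uz !map_higher_block tail_higher_block add0r.
move=> /higher_block_eqP xw /higher_block_eqP xz; apply/higher_block_eqP => j hj.
have [h|h] := ltrP 0 j; first by rewrite yz ?xz //; lia.
have -> : j = 0 by lia.
apply: det => //; first by rewrite yz ?xz //; lia.
by apply/esym; apply: (xw 0); lia.
Qed.

End block_hom.

(** * The block textile *)

Section block_textile.
Variables (n : nat) (B A : finType) (Z : set (conf B)) (W : set (conf A)).
Hypotheses (sZ : shift_invariant Z) (sW : shift_invariant W).
Variables (p q : B -> A) (psi : conf A -> conf A).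
Hypotheses (pZ : map_conf p @` Z = W) (qZ : map_conf q @` Z = W)
  (injp : {in Z &, injective (map_conf p)})
  (psiE : forall z, Z z -> psi (map_conf p z) = map_conf q z)
  (endo : endomorphism W psi)
  (ftZ : finite_type n.+1 Z) (ftW : finite_type n.+1 W).

Let pZW z : Z z -> W (map_conf p z).
Proof. by move=> Zz; rewrite -pZ; exists z. Qed.
Let qZW z : Z z -> W (map_conf q z).
Proof. by move=> Zz; rewrite -qZ; exists z. Qed.

Definition block_textile : textile (block_graph n sZ) (block_graph n sW) :=
  Textile (block_hom n sZ sW pZW) (block_hom n sZ sW qZW).

(** Both p and q map Z onto W, so orbits can be continued in both time
    directions. *)
Lemma full_orbit z : Z z -> exists zs : int -> conf B, zs 0 = z /\
  forall i, Z (zs i) /\ map_conf q (zs (i - 1)) = map_conf p (zs i).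
Proof.
move=> Zz.
(* Points outside Z get a dummy image, so that choice gives total maps. *)
have /choice[next hnext] : forall y, exists y', Z y ->
    Z y' /\ map_conf q y = map_conf p y'.
  move=> y; have [Zy|] := pselect (Z y); last by exists y.
  by have := qZW Zy; rewrite -pZ => -[y' Zy' E]; exists y' => _.
have /choice[prev hprev] : forall y, exists y', Z y ->
    Z y' /\ map_conf q y' = map_conf p y.
  move=> y; have [Zy|] := pselect (Z y); last by exists y.
  by have := pZW Zy; rewrite -qZ => -[y' Zy' E]; exists y' => _.
pose zs (i : int) := match i with
  | Posz k => iter k next z | Negz k => iter k.+1 prev z end.
have Zpos k : Z (iter k next z) by elim: k => //= k /hnext[].
have Zneg k : Z (iter k prev z) by elim: k => //= k /hprev[].
exists zs; split=> // -[[|k]|k]; split.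
- exact: Zz.
- by have [] := hprev z Zz.
- exact: Zpos k.+1.
- rewrite (_ : Posz k.+1 - 1 = Posz k); last by lia.
  by have [] := hnext _ (Zpos k).
- exact: Zneg k.+1.
- rewrite (_ : Negz k - 1 = Negz k.+1); last by lia.
  by have [] := hprev _ (Zneg k.+1).
Qed.

Lemma block_textile_base : textile_base block_textile = edge_shift (block_graph n sZ).
Proof.
apply/seteqP; split=> [_ [zs <- /(_ 0)[]]|x ex] //.
have [z Zz xz] := edge_shift_block_graph ftZ ex.
have [zs [zs0 hzs]] := full_orbit Zz.
have Zzs i : Z (zs i) by have [] := hzs i.
exists (fun i => block_path n sZ (Zzs i)).
  by apply/funext => j; apply: val_inj; rewrite /= zs0 xz.
move=> i; split; first exact: block_pathP.
have [_ E] := hzs i; apply/funext => j; apply: val_inj => /=.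
by rewrite !map_higher_block E.
Qed.

Lemma block_textile_resolving (P : textile_property) : P _ _ block_textile ->
  resolving_endo P (higher_block_shift n.+1 W) (higher_block_endo (ltn0Sn n) psi).
Proof.
move=> PT; split.
- apply: conjugate_endomorphism => //.
  + exact: higher_blockK.
  + exact: local_higher_block.
  + exact: local_first_track.
  + by move=> x _; rewrite higher_block_sigma.
- apply: conjugate_onto; first exact: higher_blockK.
  apply/seteqP; split=> [_ [w + <-]|w].
    by rewrite -{1}pZ => -[z Zz <-]; rewrite psiE //; apply: qZW.
  rewrite -{1}qZ => -[z Zz <-]; exists (map_conf p z); first exact: pZW.
  exact: psiE.
exists (block_graph n sW), val; split; first exact: block_graph_presentation.
exists (block_graph n sZ), block_textile; rewrite block_textile_base; split=> //.
- apply/seteqP; split=> [_ [x ex <-]|y ey]; first exact: block_hom_edge.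
  have [w] := edge_shift_block_graph ftW ey.
  rewrite -{1}pZ => -[z Zz <-] yw; exists (block_path n sZ Zz).
    exact: block_pathP.
  by apply/funext => j; apply: val_inj; rewrite yw /= map_higher_block.
- move=> x y; rewrite !inE => ex ey exy.
  have [z Zz xz] := edge_shift_block_graph ftZ ex.
  have [z' Zz' yz] := edge_shift_block_graph ftZ ey.
  have : z = z'.
    apply: injp; rewrite ?inE //.
    apply: (can_inj (higher_blockK (ltn0Sn n))).
    by rewrite -(block_hom_path sW pZW xz) -(block_hom_path sW pZW yz) -exy.
  by move=> zz'; apply/funext => j; apply: val_inj; rewrite xz yz zz'.
- move=> x ex; have [z Zz xz] := edge_shift_block_graph ftZ ex.
  rewrite (block_hom_path sW pZW xz) (block_hom_path sW qZW xz).
  by rewrite /higher_block_endo /= higher_blockK psiE.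
Qed.

End block_textile.

(** * From weakly resolving to resolving *)

Section weak_to_resolving.
Variables (A : finType) (W : set (conf A)) (psi : conf A -> conf A).

(** Arcs of G that occur in the presentation are symbols of W, so both codes
    can be taken with values in the alphabet of W.  Symbols occurring nowhere
    are sent to an arbitrary letter; hence the restriction of the last clause
    to symbols of points of Z. *)
Lemma weakly_endo_codes (P : textile_property) : weakly_endo P W psi ->
  exists (Gamma G : graph) (T : textile Gamma G) (Z : set (conf (arcs Gamma)))
      (p q : arcs Gamma -> A),
    [/\ P Gamma G T, closed Z, shift_invariant Z & Z `<=` edge_shift Gamma] /\
    [/\ {in Z &, injective (map_conf p)}, map_conf p @` Z = W,
        forall z, Z z -> psi (map_conf p z) = map_conf q z &
        forall z y i, Z z -> Z y -> q (z i) = q (y i) ->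
          hA (tq T) (z i) = hA (tq T) (y i)].
Proof.
case=> -[cA _ _] _ [Gamma [G [T [Z [C [eA [eG]]]]]]] /=.
case=> PT eAi eGi [[cZ sZ ZE] [inj pZ qZ psiE]].
have /card_gt0P[a0 _] : (0 < #|A|)%N by apply: ltnW.
(* r inverts eA on its image, which contains all symbols that occur. *)
pose r c := odflt a0 [pick a | eA a == c].
have rK a : r (eA a) = a.
  rewrite /r; case: pickP => [b /eqP/eAi //|/(_ a)]; by rewrite eqxx.
pose p b := r (eG (hA (tp T) b)); pose q b := r (eG (hA (tq T) b)).
have ep z j : Z z -> eA (p (z j)) = eG (hA (tp T) (z j)).
  move=> Zz; have : (map_conf eA @` W) (map_conf eG (code (tp T) z)).
    by rewrite -pZ; exists z.
  move=> [w _ E]; rewrite /p; have /(congr1 (@^~ j)) := E.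
  by rewrite /map_conf /code /= => <-; rewrite rK.
have eqq z j : Z z -> eA (q (z j)) = eG (hA (tq T) (z j)).
  move=> Zz; have : (map_conf eA @` W) (map_conf eG (code (tq T) z)).
    by apply: qZ; exists z.
  move=> [w _ E]; rewrite /q; have /(congr1 (@^~ j)) := E.
  by rewrite /map_conf /code /= => <-; rewrite rK.
have Epz z : Z z -> map_conf eG (code (tp T) z) = map_conf eA (map_conf p z).
  by move=> Zz; apply/funext => j; rewrite /map_conf ep.
have eAinj := map_conf_inj eAi.
have pW z : Z z -> W (map_conf p z).
  move=> Zz; have : (map_conf eA @` W) (map_conf eA (map_conf p z)).
    by rewrite -Epz // -pZ; exists z.
  by case=> w Ww /eAinj <-.
exists Gamma, G, T, Z, p, q; split; split=> //.
- exact/shift_invariantP.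
- move=> x y Zx Zy xy; apply: inj => //.
  by rewrite !Epz ?xy // -in_setE.
- apply/seteqP; split=> [_ [z Zz <-]|w Ww]; first exact: pW.
  have : (map_conf eA @` W) (map_conf eA w) by exists w.
  by rewrite -pZ => -[z Zz]; rewrite Epz // => /eAinj <-; exists z.
- move=> z Zz; apply: eAinj; rewrite (psiE _ z) ?Epz //; last exact: pW.
  by apply/funext => j; rewrite /map_conf eqq.
- by move=> z y i Zz Zy /(congr1 eA); rewrite !eqq // => /eGi.
Qed.

Variable N : nat.
Hypotheses (onpsi : onto W psi) (ftW : finite_type N W)
  (H : {in W &, injective psi} \/ transitive_conf W).

(** Ontoness and injectivity of psi pass to q, since q factors as psi after
    p on Z. *)
Let q_track_properties (B : finType) (Z : set (conf B)) (p q : B -> A) :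
  closed Z -> shift_invariant Z -> {in Z &, injective (map_conf p)} ->
  map_conf p @` Z = W -> (forall z, Z z -> psi (map_conf p z) = map_conf q z) ->
  [/\ map_conf q @` Z = W, exists M, finite_type M Z
    & {in Z &, injective (map_conf q)} \/ transitive_conf Z].
Proof.
move=> cZ sZ injp pZ psiE; split.
- transitivity (psi @` (map_conf p @` Z)); last by rewrite pZ.
  by rewrite image_comp; apply: eq_imagel => z Zz /=; rewrite psiE.
- exact: (finite_type_lift cZ sZ injp pZ ftW).
- case: H => [injpsi|tW]; [left|right; exact: (transitive_lift cZ sZ injp pZ tW)].
  move=> x y Zx Zy; rewrite -!psiE; try by rewrite -in_setE.
  move=> E; apply: injp => //; apply: injpsi => //.
    by rewrite inE -pZ; exists x => //; rewrite -in_setE.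
  by rewrite inE -pZ; exists y => //; rewrite -in_setE.
Qed.

Lemma weakly_qR_resolving : weakly_endo weakly_qR W psi ->
  exists (t : nat) (ht : (0 < t)%N),
    resolving_endo qR (higher_block_shift t W) (higher_block_endo ht psi).
Proof.
move=> wW; have [[_ _ /shift_invariantP sW] endo _] := wW.
have [Gamma [G [T [Z [p [q [[PT cZ sZ ZE] [injp pZ psiE hq]]]]]]]] :=
  weakly_endo_codes wW.
have [qZ [M ftZ] HZ] := q_track_properties cZ sZ injp pZ psiE.
have det : right_deterministic q Z.
  move=> z y Zz Zy j zy qzy; apply: PT; last exact: hq.
  by rewrite -(ZE z Zz) -(ZE y Zy) zy.
have [n0 hn0] := eventually_right_extendable cZ sZ sW qZ ftZ ftW HZ det.
pose n := (n0 + M + N).+1.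
have ftZn : finite_type n.+1 Z by apply: finite_type_leq ftZ; lia.
have ftWn : finite_type n.+1 W by apply: finite_type_leq ftW; lia.
exists n.+1, (ltn0Sn n).
apply: (block_textile_resolving (P := qR) (sZ := sZ) (sW := sW) (pZ := pZ) (qZ := qZ)
  injp psiE endo ftZn ftWn).
by apply: block_hom_right_resolving => //; apply: hn0; lia.
Qed.

Lemma weakly_qL_resolving : weakly_endo weakly_qL W psi ->
  exists (t : nat) (ht : (0 < t)%N),
    resolving_endo qL (higher_block_shift t W) (higher_block_endo ht psi).
Proof.
move=> wW; have [[_ _ /shift_invariantP sW] endo _] := wW.
have [Gamma [G [T [Z [p [q [[PT cZ sZ ZE] [injp pZ psiE hq]]]]]]]] :=
  weakly_endo_codes wW.
have [qZ [M ftZ] HZ] := q_track_properties cZ sZ injp pZ psiE.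
have det : left_deterministic q Z.
  move=> z y Zz Zy j zy qzy; apply: PT; last exact: hq.
  by rewrite (ZE z Zz) (ZE y Zy) zy.
have [n0 hn0] := eventually_left_extendable cZ sZ sW qZ ftZ ftW HZ det.
pose n := (n0 + M + N).+1.
have ftZn : finite_type n.+1 Z by apply: finite_type_leq ftZ; lia.
have ftWn : finite_type n.+1 W by apply: finite_type_leq ftW; lia.
exists n.+1, (ltn0Sn n).
apply: (block_textile_resolving (P := qL) (sZ := sZ) (sW := sW) (pZ := pZ) (qZ := qZ)
  injp psiE endo ftZn ftWn).
by apply: block_hom_left_resolving => //; apply: hn0; lia.
Qed.

End weak_to_resolving.

(** * The base of a textile as a weak presentation *)

(** The orbits witnessing better and better approximations of z accumulate,
    in the product over time and space, at an orbit of z itself. *)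
Lemma closed_textile_base (Gamma G : graph) (T : textile Gamma G) :
  closed (textile_base T).
Proof.
apply/closed_confP => z hz.
have /choice[u hu] : forall n : nat, exists zs : int -> conf (arcs Gamma),
    agree (- n%:Z) n%:Z (zs 0) z /\ forall i, edge_shift Gamma (zs i) /\
              code (tq T) (zs (i - 1)) = code (tp T) (zs i).
  by move=> n; have [_ [zs <- h] hn] := hz n; exists zs.
have [w hw] := cluster_seq (fun n (ij : int * int) => u n ij.1 ij.2).
exists (fun i j => w (i, j)).
  apply/funext => j; have [n jn h] := hw [:: (0, j)] (absz j).+1.
  have := h (0, j); rewrite inE /= => <- //.
  by have [-> //] := hu n; lia.
move=> i; split.
  move=> j; have [n _ h] := hw [:: (i, j); (i, j + 1)] 0.
  have := h (i, j); have := h (i, j + 1).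
  rewrite !inE !eqxx orbT => /(_ isT) <- /(_ isT) <- /=.
  by have [_ /(_ i)[/(_ j)]] := hu n.
apply/funext => j; have [n _ h] := hw [:: (i - 1, j); (i, j)] 0.
have := h (i, j); have := h (i - 1, j).
rewrite !inE !eqxx orbT /code /map_conf => /(_ isT) <- /(_ isT) <- /=.
by have [_ /(_ i)[_ /(congr1 (@^~ j))]] := hu n.
Qed.

Lemma shift_textile_base (Gamma G : graph) (T : textile Gamma G) :
  shift_invariant (textile_base T).
Proof.
move=> k _ [zs <- h]; exists (fun i => shift k (zs i)) => // i.
have [e /(congr1 (shift k)) E] := h i; split=> // j.
by rewrite /shift e; congr (ini (zs i _)); lia.
Qed.

Lemma resolving_endo_weakly (P P' : textile_property) (A : finType) (X : set (conf A))
    (phi : conf A -> conf A) :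
  (forall Gamma G (T : textile Gamma G), P _ _ T -> P' _ _ T) ->
  subshift X -> resolving_endo P X phi -> weakly_endo P' X phi.
Proof.
move=> PP' hX [endo _ [G [eG [[_ eGi XG] [Gamma [T [PT pT injT phiT]]]]]]].
have eGinj := map_conf_inj eGi.
have mapid (Y : set (conf A)) : map_conf id @` Y = Y.
  by apply/seteqP; split=> [_ [x Yx <-]|x Yx] //; exists x.
have pX : (fun z => map_conf eG (code (tp T) z)) @` textile_base T = X.
  by rewrite XG -pT image_comp.
have inX z : textile_base T z -> X (map_conf eG (code (tp T) z)).
  by move=> Tz; rewrite -pX; exists z.
split=> //; exists Gamma, G, T, (textile_base T), A, id, eG => /=.
split; [exact: PP'|exact: inj_id|exact: eGi|split; split].
- exact: closed_textile_base.
- exact/shift_invariantP/shift_textile_base.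
- by move=> _ [zs <- /(_ 0)[]].
- by move=> x y Tx Ty /eGinj; apply: injT.
- by rewrite mapid.
- rewrite mapid => _ [z Tz <-]; rewrite -phiT //.
  by have [_ sub _] := endo; apply: sub;
    exists (map_conf eG (code (tp T) z)); first exact: inX.
- by move=> x z _ Tz E; rewrite -phiT // E.
Qed.

(** * Dual blocks and the staircase textile *)

Section dual.
Variables (A : finType) (X : set (conf A)) (phi : conf A -> conf A).
Hypotheses (hX : subshift X) (hphi : endomorphism X phi).

Lemma subshift_shift : shift_invariant X.
Proof. by have [_ _ /shift_invariantP] := hX. Qed.

Lemma endo_mem x : X x -> X (phi x).
Proof. by have [_ sub _] := hphi => Xx; apply: sub; exists x. Qed.

Lemma iter_mem k x : X x -> X (iter k phi x).
Proof. by move=> Xx; elim: k => //= k; apply: endo_mem. Qed.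

Lemma endo_shift k x : X x -> phi (shift k x) = shift k (phi x).
Proof.
have [_ _ comm] := hphi.
have pos (n : nat) y : X y -> phi (shift n%:Z y) = shift n%:Z (phi y).
  move=> Xy; rewrite -!iter_sigma; elim: n => //= n <-.
  by rewrite comm // iter_sigma; apply: subshift_shift.
move=> Xx; have [h|h] : k = `|k| \/ k = - `|k| by lia.
  by rewrite h; apply: pos.
have shiftK y : shift k (shift (`|k|%:Z) y) = y.
  by apply/funext => j; rewrite /shift; congr (y _); lia.
have shiftVK y : shift (`|k|%:Z) (shift k y) = y.
  by apply/funext => j; rewrite /shift; congr (y _); lia.
rewrite -[LHS]shiftK -pos ?shiftVK //.
exact: subshift_shift.
Qed.

Lemma dual_block_shiftE s k x : X x ->
  dual_block phi s (shift k x) = shift k (dual_block phi s x).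
Proof.
move=> Xx; apply/funext => j; apply: eq_from_tnth => i.
rewrite tnth_mktuple /shift tnth_mktuple.
suff -> : iter i phi (shift k x) = shift k (iter i phi x) by [].
by elim: (i : nat) => //= m ->; rewrite endo_shift //; apply: iter_mem.
Qed.

Lemma local_endo : local_on X phi.
Proof. by have [/within_continuous_confP] := hphi. Qed.

Lemma local_comp (B : finType) (f : conf A -> conf B) :
  local_on X f -> local_on X (f \o phi).
Proof.
move=> lf x Xx n; have [m hm] := lf _ (endo_mem Xx) n.
have [k hk] := local_endo Xx m; exists k => y Xy h.
by apply: hm; [exact: endo_mem|exact: hk].
Qed.

Lemma dual_block_cons s x j :
  dual_block phi s.+1 x j = cons_tuple (x j) (dual_block phi s (phi x) j).
Proof.
apply: eq_from_tnth => i; rewrite tnth_mktuple.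
case: (unliftP ord0 i) => [i' ->|->] /=; last by rewrite tnth0.
by rewrite tnthS tnth_mktuple -iterSr.
Qed.

Lemma dual_block_rcons s x j :
  dual_block phi s.+1 x j = rcons_tuple (dual_block phi s x j) (iter s phi x j).
Proof.
apply: eq_from_tnth => i; rewrite tnth_mktuple (tnth_nth (x j)).
rewrite (_ : nth _ _ _ =
  nth (x j) (rcons (dual_block phi s x j) (iter s phi x j)) i) //.
rewrite nth_rcons size_tuple; have [h|h] := ltnP i s.
  by rewrite -(tnth_nth (x j) (dual_block phi s x j) (Ordinal h)) tnth_mktuple.
have -> : (i : nat) = s by have := ltn_ord i; lia.
by rewrite eqxx.
Qed.

Lemma local_dual_block s : local_on X (dual_block phi s).
Proof.
elim: s => [|s IH] x Xx n.
  by exists 0 => y _ _ j _; apply: eq_from_tnth => -[].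
have [m hm] := local_comp IH Xx n.
exists (maxn m n) => y Xy h j hj; rewrite !dual_block_cons.
rewrite h; last by lia.
congr cons_tuple; apply: hm => //.
by apply: agree_sub h; lia.
Qed.

(** The first track of a limit is a limit of points of X, and by continuity of
    the dual block map the other tracks are those of this first track. *)
Lemma dual_block_closed s (s0 : (0 < s)%N) : closed (dual_block_shift phi s X).
Proof.
apply/closed_confP => y hy; pose x := first_track s0 y.
have Xx : X x.
  have [_ /closed_confP cX _] := hX; apply: cX => n.
  have [_ [x' Xx' <-] h] := hy n; exists x' => // j hj.
  by rewrite /x /first_track -h // tnth_mktuple.
exists x => //; apply/funext => j.
have [m hm] := local_dual_block s Xx (absz j).+1.
have [_ [x' Xx' <-] h] := hy (maxn m (absz j).+1).
rewrite -h; last by lia.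
apply/esym; apply: hm => //; last by lia.
move=> i hi; rewrite /x /first_track -h ?tnth_mktuple //; lia.
Qed.

Lemma dual_block_subshift s (s0 : (0 < s)%N) : subshift (dual_block_shift phi s X).
Proof.
have [cA _ _] := hX; split; [|exact: dual_block_closed|].
  by rewrite card_tuple -{1}(exp1n s) ltn_exp2r.
apply/shift_invariantP => k _ [x Xx <-]; rewrite -dual_block_shiftE //.
by exists (shift k x) => //; apply: subshift_shift.
Qed.

Lemma sigma_shift (B : finType) (x : conf B) : sigma x = shift 1 x.
Proof. by []. Qed.

Lemma dual_block_endomorphism s (s0 : (0 < s)%N) :
  endomorphism (dual_block_shift phi s X) (dual_block_endo s0 phi).
Proof.
apply: conjugate_endomorphism => //.
- exact: dual_blockK.
- exact: local_dual_block.
- exact: local_first_track.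
- by move=> x Xx; rewrite !sigma_shift dual_block_shiftE.
Qed.

Lemma dual_block_homeomorphism s (s0 : (0 < s)%N) :
  homeomorphism X (dual_block_shift phi s X) (dual_block phi s).
Proof.
split.
- by apply/within_continuous_confP; apply: local_dual_block.
- split=> [x Xx|x y _ _|//]; first by exists x.
  by move/(congr1 (first_track s0)); rewrite !dual_blockK.
- exists (first_track s0); last by move=> x _; rewrite dual_blockK.
  by apply/within_continuous_confP; apply: local_first_track.
Qed.

End dual.

Section dual_textile.
Variables (Gamma G : graph) (T : textile Gamma G) (s : nat).

Definition power_graph (k : nat) : graph := @Graph
  (k.-tuple (arcs G)) (k.-tuple (verts G)) (map_tuple (@ini G)) (map_tuple (@ter G)).

Definition staircase_graph : graph := @Graph
  (arcs Gamma * s.-tuple (arcs G))%type (verts Gamma * s.-tuple (verts G))%type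
  (fun a => (ini a.1, map_tuple (@ini G) a.2))
  (fun a => (ter a.1, map_tuple (@ter G) a.2)).

Let p_arc (a : arcs staircase_graph) : arcs (power_graph s.+1) :=
  cons_tuple (hA (tp T) a.1) a.2.
Let p_vert (v : verts staircase_graph) : verts (power_graph s.+1) :=
  cons_tuple (hV (tp T) v.1) v.2.
Let q_arc (a : arcs staircase_graph) : arcs (power_graph s.+1) :=
  rcons_tuple a.2 (hA (tq T) a.1).
Let q_vert (v : verts staircase_graph) : verts (power_graph s.+1) :=
  rcons_tuple v.2 (hV (tq T) v.1).

Let p_ini a : ini (p_arc a) = p_vert (ini a).
Proof. by apply: val_inj; rewrite /= hom_ini. Qed.
Let p_ter a : ter (p_arc a) = p_vert (ter a).
Proof. by apply: val_inj; rewrite /= hom_ter. Qed.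
Let q_ini a : ini (q_arc a) = q_vert (ini a).
Proof. by apply: val_inj; rewrite /= map_rcons hom_ini. Qed.
Let q_ter a : ter (q_arc a) = q_vert (ter a).
Proof. by apply: val_inj; rewrite /= map_rcons hom_ter. Qed.

Definition staircase : textile staircase_graph (power_graph s.+1) :=
  Textile (GraphHom p_ini p_ter) (GraphHom q_ini q_ter).

Lemma staircase_qR : weakly_qR T -> weakly_qR staircase.
Proof.
move=> H [a c] [b d] [iab _] /(congr1 val) /= /rcons_inj[/val_inj -> qab].
by rewrite (H a b iab qab).
Qed.

Lemma staircase_qL : weakly_qL T -> weakly_qL staircase.
Proof.
move=> H [a c] [b d] [iab _] /(congr1 val) /= /rcons_inj[/val_inj -> qab].
by rewrite (H a b iab qab).
Qed.

End dual_textile.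

(** The subshift of the staircase consists of the pairs (z, c) where z is in Z,
    p z is a point x of X and c lists the tracks phi x, ..., phi^(s-1) x.  Each
    track is the p-image of a point of Z, hence a path in G. *)
Lemma weakly_endo_dual (P : textile_property) (A : finType) (X : set (conf A))
    (phi : conf A -> conf A) (s : nat) (s0 : (0 < s)%N) :
  (forall Gamma G (T : textile Gamma G) k, P _ _ T -> P _ _ (staircase T k)) ->
  endomorphism X phi -> weakly_endo P X (iter s phi) ->
  weakly_endo P (dual_block_shift phi s X) (dual_block_endo s0 phi).
Proof.
move=> PS hphi; case: s s0 => // s s0.
case=> hX _ [Gamma [G [T [Z [C [eA [eG]]]]]]] /=.
case=> PT eAi eGi [[cZ sZ ZE] [inj pZ qZ phiE]].
have {sZ} sZ : shift_invariant Z by apply/shift_invariantP.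
split; [exact: dual_block_subshift|exact: dual_block_endomorphism|].
pose S := staircase_graph Gamma G s.
pose zfst (z : conf (arcs S)) : conf (arcs Gamma) := fun j => (z j).1.
(* E z x: the columns of z display x and its images under phi. *)
pose E (z : conf (arcs S)) x := map_conf eG (code (tp T) (zfst z)) = map_conf eA x /\
  forall j, map_tuple eG (z j).2 = map_tuple eA (dual_block phi s (phi x) j).
pose Z' : set (conf (arcs S)) := [set z | Z (zfst z) /\ exists2 x, X x & E z x].
have pE z x : E z x -> map_conf (map_tuple eG) (code (tp (staircase T s)) z)
    = map_conf (map_tuple eA) (dual_block phi s.+1 x).
  move=> [/(congr1 (fun u => u _)) e1 e2]; apply/funext => j.
  rewrite /map_conf dual_block_cons.
  apply: val_inj => /=; congr (_ :: _); first exact: e1.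
  exact: (congr1 val (e2 j)).
have qE z x : Z (zfst z) -> X x -> E z x ->
    map_conf (map_tuple eG) (code (tq (staircase T s)) z)
    = map_conf (map_tuple eA) (dual_block phi s.+1 (phi x)).
  move=> Zz Xx [e1 e2]; apply/funext => j; rewrite /map_conf dual_block_rcons.
  apply: val_inj; rewrite /= !map_rcons; congr rcons.
    exact: (congr1 val (e2 j)).
  by rewrite -iterSr; have /(congr1 (@^~ j)) := phiE x _ Xx Zz e1.
have lift x : X x -> exists2 z, Z z & map_conf eG (code (tp T) z) = map_conf eA x.
  move=> Xx; have : (map_conf eA @` X) (map_conf eA x) by exists x.
  by rewrite -pZ => -[z Zz zx]; exists z.
have eAinj := map_conf_inj eAi.
exists S, (power_graph G s.+1), (staircase T s), Z', (s.+1.-tuple C : finType),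
  (map_tuple eA), (map_tuple eG) => /=.
split; [exact: PS|exact: map_tuple_inj|exact: map_tuple_inj|split; split].
- apply/closed_confP => z hz.
  have Zz : Z (zfst z).
    move/closed_confP: cZ; apply => n; have [y [Zy _] h] := hz n.
    by exists (zfst y) => // j hj; rewrite /zfst h.
  split=> //; have : (map_conf eA @` X) (map_conf eG (code (tp T) (zfst z))).
    by rewrite -pZ; exists (zfst z).
  case=> x Xx xz; exists x => //; split=> // j.
  have [m hm] := local_comp hphi (local_dual_block hphi s) Xx (absz j).+1.
  have [y [Zy [x' Xx' [e1 e2]]] h] := hz (maxn m (absz j).+1).
  rewrite -h ?e2; last by lia.
  congr map_tuple; apply: (hm x' Xx') => [i hi|]; last by lia.
  apply: eAi; have := congr1 (@^~ i) e1; have := congr1 (@^~ i) xz.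
  by rewrite /map_conf /code /= /zfst => -> <-; rewrite /map_conf h //; lia.
- apply/shift_invariantP => k z [Zz [x Xx [e1 e2]]]; split.
    exact: (sZ k (zfst z)).
  exists (shift k x); first exact: (subshift_shift hX).
  split; first exact: (congr1 (shift k) e1).
  move=> j; rewrite (endo_shift hX hphi) // (dual_block_shiftE hX hphi) //.
    exact: e2.
  exact: (endo_mem hphi).
- move=> z [Zz [x Xx [e1 e2]]] j /=; congr pair; first exact: (ZE (zfst z) Zz j).
  apply: eq_from_tnth => i; rewrite !tnth_map.
  have [y Zy yx] := lift _ (iter_mem hphi i (endo_mem hphi Xx)).
  have zy k : tnth (z k).2 i = hA (tp T) (y k).
    apply: eGi; have := congr1 (fun t => tnth t i) (e2 k).
    by rewrite !tnth_map tnth_ord_tuple => ->; have /(congr1 (@^~ k)) := yx.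
  by rewrite !zy hom_ter hom_ini (ZE y Zy).
- move=> z y; rewrite !inE => -[Zz _] [Zy _] zy.
  have zy1 : zfst z = zfst y.
    apply: inj; rewrite ?inE //; apply/funext => j.
    by have /(congr1 (fun u => thead (u j))) := zy.
  apply/funext => j; rewrite [LHS]surjective_pairing [RHS]surjective_pairing.
  congr pair; first exact: (congr1 (@^~ j) zy1).
  apply: (map_tuple_inj eGi); apply: val_inj.
  by have /(congr1 (fun u => behead (val (u j)))) := zy.
- apply/seteqP; split=> [_ [z [Zz [x Xx Ezx]] <-]|_ [_ [x Xx <-] <-]].
    by rewrite (pE _ _ Ezx); exists (dual_block phi s.+1 x) => //; exists x.
  have [z0 Zz0 z0x] := lift x Xx.
  have /choice[zs hzs] : forall i : 'I_s, exists z, Z z /\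
      map_conf eG (code (tp T) z) = map_conf eA (iter i phi (phi x)).
    move=> i; have [z Zz zx] := lift _ (iter_mem hphi i (endo_mem hphi Xx)).
    by exists z.
  pose z : conf (arcs S) := fun j => (z0 j, [tuple hA (tp T) (zs i j) | i < s]).
  have Ezx : E z x.
    split=> // j; apply: eq_from_tnth => i; rewrite !tnth_map !tnth_ord_tuple.
    by have [_ /(congr1 (@^~ j))] := hzs i.
  by exists z; [split=> //; exists x|exact: pE].
- move=> _ [z [Zz [x Xx Ezx]] <-]; rewrite (qE _ _ Zz Xx Ezx).
  exists (dual_block phi s.+1 (phi x)) => //; exists (phi x) => //.
  exact: (endo_mem hphi).
- move=> _ z [x' Xx' <-] [Zz [x Xx Ezx]]; rewrite (pE _ _ Ezx).
  move=> /(map_conf_inj (map_tuple_inj eAi)) /(congr1 (first_track s0)).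
  rewrite !dual_blockK => <-; rewrite (qE _ _ Zz Xx Ezx).
  by rewrite /dual_block_endo /= dual_blockK.
Qed.

Lemma dual_essentially_weakly_endo (P : textile_property) (A : finType)
    (X : set (conf A)) (phi : conf A -> conf A) (s : nat) (s0 : (0 < s)%N) :
  subshift X -> endomorphism X phi ->
  weakly_endo P (dual_block_shift phi s X) (dual_block_endo s0 phi) ->
  essentially_weakly_endo P X phi.
Proof.
move=> hX hphi wP.
exists (s.-tuple A : finType), (dual_block_shift phi s X), (dual_block_endo s0 phi),
  (dual_block phi s); split=> //.
- exact: (dual_block_homeomorphism hphi s0).
- by move=> x Xx; rewrite !sigma_shift (dual_block_shiftE hX hphi).
- by move=> x Xx; rewrite /dual_block_endo /= dual_blockK.
Qed.

Lemma topological_markov_finite_type (A : finType) (X : set (conf A)) :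
  topological_markov_shift X -> finite_type 2 X.
Proof.
move=> [G [eG [_ eGi XG]]] z hz.
have /choice[x hx] : forall j, exists a, eG a = z j.
  move=> j; have [y] := hz j; rewrite XG => -[x _ <-] h.
  by exists (x j); apply: h; lia.
rewrite XG; exists x; last by apply/funext => j; apply: hx.
move=> j; have [y] := hz j; rewrite XG => -[x' ex' <-] h.
have E i : j <= i < j + 2%:Z -> x i = x' i.
  by move=> hi; apply: eGi; rewrite hx; apply/esym; apply: h.
by rewrite !E ?ex' //; lia.
Qed.

(** * The dual block shift of a Markov shift *)

(** The first track is a symbol map from the dual block shift onto X which is
    injective there, so finite type and transitivity lift along it. *)
Section dual_properties.
Variables (A : finType) (X : set (conf A)) (phi : conf A -> conf A).
Variables (s : nat) (s0 : (0 < s)%N).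
Hypotheses (hX : subshift X) (hphi : endomorphism X phi).

Let W := dual_block_shift phi s X.

Let track_inj :
  {in W &, injective (map_conf (fun t : s.-tuple A => tnth t (Ordinal s0)))}.
Proof.
move=> y y'; rewrite !inE => -[x Xx <-] [x' Xx' <-] E.
rewrite -(dual_blockK phi s0 x) -(dual_blockK phi s0 x').
by rewrite /first_track; congr dual_block.
Qed.

Let track_image : map_conf (fun t : s.-tuple A => tnth t (Ordinal s0)) @` W = X.
Proof.
have trackK := dual_blockK phi s0.
apply/seteqP; split=> [_ [_ [x Xx <-] <-]|x Xx].
  by rewrite [Y in X Y](trackK x).
by exists (dual_block phi s x); [exists x|exact: trackK].
Qed.

Let W_shift : shift_invariant W.
Proof. exact: subshift_shift (dual_block_subshift hX hphi s0). Qed.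

Lemma dual_finite_type N : finite_type N X -> exists M, finite_type M W.
Proof.
exact: (finite_type_lift (dual_block_closed hX hphi s0) W_shift track_inj
  track_image).
Qed.

Lemma dual_transitive : transitive_conf X -> transitive_conf W.
Proof.
exact: (transitive_lift (dual_block_closed hX hphi s0) W_shift track_inj
  track_image).
Qed.

Lemma dual_onto : onto X phi -> onto W (dual_block_endo s0 phi).
Proof. by apply: conjugate_onto; apply: dual_blockK. Qed.

Lemma dual_injective : {in X &, injective phi} ->
  {in W &, injective (dual_block_endo s0 phi)}.
Proof.
move=> inj y y'; rewrite !inE => -[x Xx <-] [x' Xx' <-].
rewrite /dual_block_endo /= !dual_blockK => /(congr1 (first_track s0)).
by rewrite !dual_blockK => /inj ->; rewrite ?inE.
Qed.

Lemma dual_bijective_or_transitive :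
  set_bij X X phi \/ (onto X phi /\ topologically_transitive X) ->
  onto W (dual_block_endo s0 phi) /\
  ({in W &, injective (dual_block_endo s0 phi)} \/ transitive_conf W).
Proof.
case=> [[fX inj surj]|[onphi tX]].
  split; last by left; apply: dual_injective.
  apply: dual_onto; apply/seteqP; split=> [_ [x Xx <-]|]; first exact: fX.
  exact: surj.
split; first exact: dual_onto.
by right; apply/dual_transitive/topologically_transitive_conf.
Qed.

End dual_properties.

Theorem theorem8p6 (A : finType) (X : set (conf A)) (phi : conf A -> conf A)
    (hX : subshift X) (hphi : endomorphism X phi)
    (s : nat) (hs : (0 < s)%N) :
  ((weakly_endo weakly_qR X (iter s phi) ->
      weakly_endo weakly_qR (dual_block_shift phi s X) (dual_block_endo hs phi)
      /\ essentially_weakly_endo weakly_qR X phi)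
   /\
   (weakly_endo weakly_qL X (iter s phi) ->
      weakly_endo weakly_qL (dual_block_shift phi s X) (dual_block_endo hs phi)
      /\ essentially_weakly_endo weakly_qL X phi))
  /\
  (topological_markov_shift X ->
   set_bij X X phi \/ (onto X phi /\ topologically_transitive X) ->
   (resolving_endo qR X (iter s phi) ->
      exists (t : nat) (ht : (0 < t)%N),
        resolving_endo qR
          (higher_block_shift t (dual_block_shift phi s X))
          (higher_block_endo ht (dual_block_endo hs phi)))
   /\
   (resolving_endo qL X (iter s phi) ->
      exists (t : nat) (ht : (0 < t)%N),
        resolving_endo qL
          (higher_block_shift t (dual_block_shift phi s X))
          (higher_block_endo ht (dual_block_endo hs phi)))).
Proof.
have dualR := weakly_endo_dual hs (fun _ _ T k => @staircase_qR _ _ T k) hphi.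
have dualL := weakly_endo_dual hs (fun _ _ T k => @staircase_qL _ _ T k) hphi.
split.
  split=> [/dualR w|/dualL w]; split=> //; exact: dual_essentially_weakly_endo w.
move=> /topological_markov_finite_type mX.
move=> /(dual_bijective_or_transitive hs hX hphi)[onpsi HW].
have [N ftW] := dual_finite_type hs hX hphi mX.
split=> rX.
- apply: (weakly_qR_resolving onpsi ftW HW); apply: dualR.
  apply: resolving_endo_weakly hX rX => Gamma G T qRT a b iab qab.
  have [|c [_ uc]] := qRT (ini a) (hA (tq T) a); first exact: hom_ini.
  by rewrite -(uc a) // -(uc b) // iab qab.
- apply: (weakly_qL_resolving onpsi ftW HW); apply: dualL.
  apply: resolving_endo_weakly hX rX => Gamma G T qLT a b iab qab.
  have [|c [_ uc]] := qLT (ter a) (hA (tq T) a); first exact: hom_ter.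
  by rewrite -(uc a) // -(uc b) // iab qab.
Qed.
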